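(* Let $q \in \{4,8\}$ and let $n \geq 2$ be an integer. If $S$ is a set of even type in $\mathrm{PG}(n,q)$ of size $|S| = q^{n-2}(q+2)$, then $S$ is a cylinder over a regular hyperoval, i.e. there exist skew subspaces $\pi$ and $\tau$ of $\mathrm{PG}(n,q)$ with $\dim \pi = 2$ and $\dim\tau = n-3$, and a regular hyperoval $\mathcal{O}$ in $\pi$, such that $S = \left(\bigcup_{P \in \mathcal{O}} \langle P, \tau\rangle\right)\setminus \tau$.
   Context: $\mathrm{PG}(n,q)$ is the $n$-dimensional projective space over the finite field $\mathbb{F}_q$; all dimensions are projective, and a subspace of dimension $-1$ is empty. Two subspaces are skew if they have no common point; $\langle P,\tau\rangle$ is the subspace spanned by $P$ and $\tau$. A set of even type in $\mathrm{PG}(n,q)$ is a set of points that meets every line in an even number of points (possibly $0$). For $q$ even, a hyperoval in a projective plane $\mathrm{PG}(2,q)$ is a set of $q+2$ points meeting every line in $0$ or $2$ points. A hyperoval is regular if it is projectively equivalent to $\{(s^2,st,t^2) : (s,t)\in \mathrm{PG}(1,q)\}\cup\{(0,1,0)\}$. *)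

(* Defs.v *)
From HB Require Import structures.
From mathcomp Require Import all_boot all_order all_algebra.

Set Implicit Arguments.
Unset Strict Implicit.
Unset Printing Implicit Defensive.

Import GRing.Theory VectorInternalTheory.
Local Open Scope ring_scope.

HB.instance Definition _ (F : finFieldType) (V : vectType F) :=
  [Countable of {vspace V} by <:].
HB.instance Definition _ (F : finFieldType) (V : vectType F) :=
  [Finite of {vspace V} by <:].

(* A subspace of PG(n,q) is a linear subspace of F^(n+1), with #|F| = q. *)
Definition proj_subspace (F : finFieldType) (n : nat) : Type :=
  {vspace 'rV[F]_n.+1}.

Definition pdim (F : finFieldType) (n : nat) (U : proj_subspace F n) : int :=
  (\dim U)%:Z - 1.

Record point (F : finFieldType) (n : nat) : Type := Point {
  point_space :> {vspace 'rV[F]_n.+1};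
  point_spaceP : pdim point_space == 0
}.

HB.instance Definition _ (F : finFieldType) (n : nat) :=
  [isSub for @point_space F n].
HB.instance Definition _ (F : finFieldType) (n : nat) :=
  [Finite of point F n by <:].

Definition points_of (F : finFieldType) (n : nat) (U : proj_subspace F n) :
    {set point F n} :=
  [set P : point F n | (P <= U)%VS].

Definition skew_subspaces (F : finFieldType) (n : nat) (U W : proj_subspace F n) : bool :=
  points_of U :&: points_of W == set0.

Definition even_type (F : finFieldType) (n : nat) (S : {set point F n}) : Prop :=
  forall l : proj_subspace F n, pdim l = 1 -> ~~ odd #|S :&: points_of l|.

Definition is_hyperoval (F : finFieldType) (n : nat) (pi : proj_subspace F n)
    (O : {set point F n}) : Prop :=
  [/\ pdim pi = 2,
      O \subset points_of pi,
      #|O| = (#|F| + 2)%N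
    & forall l : proj_subspace F n, pdim l = 1 -> (l <= pi)%VS ->
        #|O :&: points_of l| = 0%N \/ #|O :&: points_of l| = 2%N].

Definition row3 (F : finFieldType) (x y z : F) : 'rV[F]_3 :=
  \row_(i < 3) [:: x; y; z]`_i.

Definition conic_nucleus (F : finFieldType) : {set point F 2} :=
  [set P : point F 2 |
    [exists s : F, exists t : F,
       ((s, t) != (0, 0)) &&
       (point_space P == <[(row3 (s ^+ 2) (s * t) (t ^+ 2))%R]>%VS)]
    || (point_space P == <[(row3 0 1 0)%R]>%VS)].

Definition map_points (F : finFieldType) (m n : nat)
    (f : 'Hom('rV[F]_m.+1, 'rV[F]_n.+1)) (A : {set point F m}) :
    {set point F n} :=
  [set Q : point F n |
    [exists P in A, point_space Q == (f @: point_space P)%VS]].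

(* The projective equivalence is a linear bijection from F^3 onto pi.
   Semilinear maps would give the same notion, because field automorphisms
   stabilise conic_nucleus. *)
Definition is_regular_hyperoval (F : finFieldType) (n : nat)
    (pi : proj_subspace F n) (O : {set point F n}) : Prop :=
  is_hyperoval pi O /\
  exists f : 'Hom('rV[F]_3, 'rV[F]_n.+1),
    [/\ lker f = 0%VS, limg f = pi & O = map_points f (conic_nucleus F)].

(* Main.v *)
Require Import Defs.
From mathcomp Require Import all_boot all_order all_algebra all_field zify ring.

(* Fix a point P of S.  Every line through P carries a further point of S, so the size of S in a
   subspace W through P is 1 plus the number of lines of W through P plus an excess, namely the sum
   of |L n S| - 2 over these lines L.  In a solid the bound |S| <= q^2 + 2 q leaves an excess of at
   most q - 2, i.e. 2 for q = 4 and 6 for q = 8, and double counting of the plane sections shows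
   that the excess comes from one q-secant through each point of S; the q-secants then concur.
   In general a 2-secant lies in a plane T meeting S in q + 2 points.  Adding up over the solids
   through T, each of them meets S in exactly q^2 + 2 q points.  It follows that the point V missing
   on a q-secant is joined to every point of S by a q-secant.  These points V form a subspace tau
   complementary to T, and S is the cylinder with vertex tau over the hyperoval T n S.
   Finally T n S is written as the graph {(1, t, f t)} with two points at infinity.  The slopes of f
   at any point run over all field elements; for q = 8 this forces f = a x^2 + b x^4 + c x^6 and the
   sum of the cubes of the slopes at 0 gives a (a c + b^2) = 0, whence regularity. *)

Set Implicit Arguments.
Unset Strict Implicit.
Unset Printing Implicit Defensive.

Import GRing.Theory.

(** * Subspaces and pencils *)

Lemma cards3 (I : finType) (x y z : I) : x != y -> x != z -> y != z -> #|x |: [set y; z]| = 3.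
Proof. by move=> xy xz yz; rewrite cardsU1 cards2 !inE negb_or xy xz yz. Qed.

Section Subspaces.
Variables (F : finFieldType) (n : nat).
Local Notation V := 'rV[F]_n.+1.
Local Notation pt := (point F n).
Local Notation q := #|F|.
Implicit Types (U W X L M A B : {vspace V}) (P Q R : pt) (E : {set pt}).

Lemma q_gt1 : 1 < q.
Proof. exact: finNzRing_gt1. Qed.

Lemma pdimE U (k : nat) : (pdim (U : proj_subspace F n) = (k%:Z)%R) <-> \dim U = k.+1.
Proof. by rewrite /pdim; split; lia. Qed.

Lemma pdim_line U : \dim U = 2 -> pdim (U : proj_subspace F n) = 1%R.
Proof. by rewrite /pdim => ->. Qed.

Lemma dim_point P : \dim P = 1.
Proof. by apply/pdimE/eqP/point_spaceP. Qed.

Lemma in_points_of U P : (P \in points_of U) = (P <= U)%VS.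
Proof. by rewrite inE. Qed.

Lemma pt_vline_proof (v : V) : v != 0%R -> pdim (<[v]>%VS : proj_subspace F n) == 0%R.
Proof. by move=> v0; apply/eqP/pdimE; rewrite dim_vline v0. Qed.

Definition vpt (v : V) (v0 : v != 0%R) : pt := Point (pt_vline_proof v0).

Lemma point_inj P Q : (P : {vspace V}) = Q -> P = Q.
Proof. exact: val_inj. Qed.

Lemma point_exists_vec P : exists2 v : V, v != 0%R & (P : {vspace V}) = <[v]>%VS.
Proof.
have Pv : vpick P \in (P : {vspace V}) by exact: memv_pick.
have v0 : vpick P != 0%R.
  by rewrite vpick0 -dimv_eq0 dim_point.
exists (vpick P) => //; apply/eqP; rewrite eq_sym eqEdim -memvE Pv.
by rewrite dim_point dim_vline v0.
Qed.

Lemma subv_points P Q : (P <= Q)%VS -> P = Q.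
Proof. by move=> PQ; apply: point_inj; apply/eqP; rewrite eqEdim PQ !dim_point. Qed.

Lemma subv_vs_points P Q : (P <= Q)%VS = (P == Q).
Proof. by apply/idP/eqP => [/subv_points|->]. Qed.

Lemma dim_cap_point U P : \dim (U :&: P) = (P <= U)%VS.
Proof.
have [/capv_idPr -> | nPU] := boolP (P <= U)%VS; first by rewrite dim_point.
have := dimvS (capvSr U P); rewrite dim_point leq_eqVlt ltnS leqn0.
case/orP => /eqP // d1; case/negP: nPU; apply/capv_idPr/eqP.
by rewrite eqEdim capvSr dim_point d1.
Qed.

Lemma dim_add_point U P : ~~ (P <= U)%VS -> \dim (U + P) = (\dim U).+1.
Proof.
move=> /negbTE nPU; have := dimv_sum_cap U P.
by rewrite dim_cap_point nPU dim_point addn0 addn1.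
Qed.

Lemma dim_join P Q : P != Q -> \dim (P + Q) = 2.
Proof. by move=> PQ; rewrite dim_add_point ?dim_point // subv_vs_points eq_sym. Qed.

Lemma eq_dim U W : (U <= W)%VS -> \dim W <= \dim U -> U = W.
Proof. by move=> UW dWU; apply/eqP; rewrite eqEdim UW. Qed.

Lemma point_exists U : 0 < \dim U -> exists P : pt, (P <= U)%VS.
Proof.
rewrite lt0n dimv_eq0 -vpick0 => v0; exists (vpt v0).
by rewrite -memvE memv_pick.
Qed.

Lemma point_notin U W : ~~ (W <= U)%VS -> exists2 P : pt, (P <= W)%VS & ~~ (P <= U)%VS.
Proof.
move=> /subvPn [v vW vU].
have v0 : v != 0%R by apply: contraNneq vU => ->; rewrite mem0v.
by exists (vpt v0); rewrite -memvE.
Qed.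

Lemma subv_pointsP U W : (forall P, (P <= U)%VS -> (P <= W)%VS) -> (U <= W)%VS.
Proof.
move=> UW; apply/negPn/negP => /point_notin [P PU]; rewrite UW //.
Qed.

(** This is (q^m - 1)/(q - 1), the number of points of a subspace of vector space dimension [m],
    that is, of projective dimension m - 1. *)
Definition theta (m : nat) := \sum_(i < m) q ^ i.

Lemma theta_geo m : (q - 1) * theta m = q ^ m - 1.
Proof. by rewrite !subn1 predn_exp. Qed.

Lemma theta_S m : theta m.+1 = theta m + q ^ m.
Proof. by rewrite /theta big_ord_recr. Qed.

Lemma theta_0 : theta 0 = 0. Proof. by rewrite /theta big_ord0. Qed.

Lemma card_points U : #|points_of U| = theta (\dim U).
Proof.
have q1 := q_gt1; apply/eqP; rewrite -(eqn_pmul2l (m := q - 1)) ?subn_gt0 //.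
rewrite theta_geo -(card_vspace U); apply/eqP.
have h : #|[set v in U | v != 0%R]| = (#|U| - 1)%N.
  rewrite [in RHS](cardD1 0%R) mem0v add1n subn1 /=.
  by apply: eq_card => v; rewrite !inE andbC.
rewrite mulnC -h -[RHS]sum1_card.
(* Sort the nonzero vectors of [U] by the point they span; each point receives its q - 1 nonzero
   vectors. *)
rewrite (partition_big (fun v : V => <[v]>%VS) (mem [set point_space P | P in points_of U])) /=; last first.
  move=> v; rewrite inE => /andP [vU v0]; apply/imsetP; exists (vpt v0) => //.
  by rewrite in_points_of -memvE.
rewrite big_imset /=; last by move=> P Q _ _; exact: point_inj.
rewrite -sum_nat_const; apply: eq_bigr => P; rewrite in_points_of => PU.
have [v v0 Pv] := point_exists_vec P.
rewrite sum1_card -(cardsT F) (cardsD1 0%R) inE add1n subn1 /=.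
have inj : injective (fun a : F => a *: v)%R.
  move=> a b /= /eqP; rewrite -subr_eq0 -scalerBl scaler_eq0 (negbTE v0) orbF.
  by rewrite subr_eq0 => /eqP.
rewrite -(card_imset _ inj); apply: eq_card => w.
apply/imsetP/idP => [[a] | ]; rewrite [w \in _]unfold_in /= !inE.
  rewrite andbT => a0 ->; rewrite scaler_eq0 negb_or a0 v0 andbT.
  have avP : (a *: v)%R \in (P : {vspace V}) by rewrite Pv; apply/memvZ/memv_line.
  rewrite [_ \in U]memvE (subv_trans _ PU) -?memvE //=.
  by rewrite eqEdim -memvE avP dim_point dim_vline scaler_eq0 negb_or a0 v0.
case/andP => /andP [wU w0] /eqP wP.
have : w \in <[v]>%VS by rewrite -Pv -wP memv_line.
case/vlineP => a wa; exists a => //; rewrite !inE andbT.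
by move: w0; rewrite wa scaler_eq0 negb_or => /andP [].
Qed.

(** For [U] inside [W] these are the points of the quotient W/U: the lines through a point, the
    planes through a line, the solids through a plane. *)
Definition ext U W : {set {vspace V}} :=
  [set X | [&& (U <= X)%VS, (X <= W)%VS & \dim X == (\dim U).+1]].

Lemma extP U W X : reflect [/\ (U <= X)%VS, (X <= W)%VS & \dim X = (\dim U).+1] (X \in ext U W).
Proof. by rewrite inE; apply: (iffP and3P) => [] [? ? /eqP]. Qed.

Lemma ext_join U W P : (U <= W)%VS -> (P <= W)%VS -> ~~ (P <= U)%VS -> (U + P)%VS \in ext U W.
Proof.
move=> UW PW PU; apply/extP; split; rewrite ?addvSl ?dim_add_point //.
by rewrite subv_add UW.
Qed.

Lemma ext_joinE U W X P : X \in ext U W -> (P <= X)%VS -> ~~ (P <= U)%VS -> X = (U + P)%VS.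
Proof.
move=> /extP [UX XW dX] PX PU; apply/esym/eq_dim; first by rewrite subv_add UX.
by rewrite dim_add_point ?dX.
Qed.

(** A point off [U] lies in exactly one member of the pencil, its join with [U]. *)
Lemma pencil E U W : (U <= W)%VS ->
  #|E :&: (points_of W :\: points_of U)| =
  \sum_(X in ext U W) #|E :&: (points_of X :\: points_of U)|.
Proof.
move=> UW; rewrite -sum1_card.
rewrite (partition_big (fun P : pt => (U + P)%VS) (mem (ext U W))) /=; last first.
  by move=> P; rewrite in_setI in_setD !in_points_of => /and3P [_ PU PW]; apply: ext_join.
apply: eq_bigr => X XE; rewrite sum1_card; apply: eq_card => P.
rewrite [LHS]unfold_in /= !in_setI !in_setD !in_points_of; case: (P \in E) => //=.
have [PU | PU] := boolP (P <= U)%VS => //=; apply/andP/idP => [[PW /eqP <-] | PX].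
  exact: addvSr.
by rewrite -(ext_joinE XE PX PU) eqxx; case/extP: XE => _ XW _; rewrite (subv_trans PX).
Qed.

(** Applied to the set of all points, [pencil] says that each member adds q^(dim U) points to
    [U]. *)
Lemma card_ext U W : (U <= W)%VS -> #|ext U W| = theta (\dim W - \dim U).
Proof.
move=> UW; have q1 := q_gt1.
have cD X : (U <= X)%VS -> #|setT :&: (points_of X :\: points_of U)| = theta (\dim X) - theta (\dim U).
  move=> UX; rewrite setTI cardsD (setIidPr _) ?card_points //.
  by apply/subsetP => P; rewrite !in_points_of => /subv_trans; apply.
have := pencil setT UW; rewrite cD //.
rewrite (eq_bigr (fun _ => q ^ \dim U)); last first.
  by move=> X /extP [UX _ dX]; rewrite cD // dX theta_S addKn.
rewrite sum_nat_const => h.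
have q0 : 0 < (q - 1) * q ^ \dim U by rewrite muln_gt0 expn_gt0; lia.
apply/eqP; rewrite -(eqn_pmul2r q0); apply/eqP.
rewrite mulnCA -h [RHS]mulnA [X in _ = X * _]mulnC theta_geo mulnBr !theta_geo mulnBl mul1n -expnD.
rewrite subnK ?dimvS //; have := expn_gt0 q (\dim U); lia.
Qed.

Lemma theta1 : theta 1 = 1. Proof. by rewrite theta_S theta_0. Qed.
Lemma theta2 : theta 2 = q + 1. Proof. by rewrite theta_S theta1 expn1 addnC. Qed.
Lemma theta3 : theta 3 = q ^ 2 + q + 1. Proof. by rewrite theta_S theta2; lia. Qed.

Lemma meet_lines A L M : \dim A = 3 -> \dim L = 2 -> \dim M = 2 ->
  (L <= A)%VS -> (M <= A)%VS -> L <> M -> exists2 R : pt, (L :&: M)%VS = R & (L + M)%VS = A.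
Proof.
move=> dA dL dM LA MA LM; have LMA : (L + M <= A)%VS by rewrite subv_add LA.
have := dimv_sum_cap L M; have := dimvS LMA; rewrite dA dL dM.
have d2 : 2 < \dim (L + M)%VS.
  have := dimvS (addvSl L M); rewrite leq_eqVlt dL => /orP [/eqP d|//].
  case: LM; have e1 : L = (L + M)%VS by apply: eq_dim; rewrite ?addvSl // dL -d.
  by apply/esym/eq_dim; rewrite ?dL ?dM // e1 addvSr.
move=> d3 ds; have d1 : \dim (L :&: M)%VS = 1 by lia.
have [P PLM] : exists P : pt, (P <= L :&: M)%VS by apply: point_exists; rewrite d1.
exists P; first by apply/esym/eq_dim; rewrite // d1 dim_point.
by apply: eq_dim; rewrite // dA.
Qed.

Lemma meet_planes X A B : \dim X = 4 -> \dim A = 3 -> \dim B = 3 ->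
  (A <= X)%VS -> (B <= X)%VS -> A <> B -> \dim (A :&: B)%VS = 2.
Proof.
move=> dX dA dB AX BX AB; have ABX : (A + B <= X)%VS by rewrite subv_add AX.
have := dimv_sum_cap A B; have := dimvS ABX; rewrite dA dB dX.
have d2 : 3 < \dim (A + B)%VS.
  have := dimvS (addvSl A B); rewrite leq_eqVlt dA => /orP [/eqP d|//].
  case: AB; have e1 : A = (A + B)%VS by apply: eq_dim; rewrite ?addvSl // dA -d.
  by apply/esym/eq_dim; rewrite ?dA ?dB // e1 addvSr.
lia.
Qed.

Lemma line_eq L P Q : \dim L = 2 -> P != Q -> (P <= L)%VS -> (Q <= L)%VS -> (P + Q)%VS = L.
Proof.
move=> dL PQ PL QL; apply: eq_dim; first by rewrite subv_add PL.
by rewrite dL dim_join.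
Qed.

End Subspaces.

(** * Secants of a set of even type *)

Section EvenSets.
Variables (F : finFieldType) (n : nat).
Local Notation V := 'rV[F]_n.+1.
Local Notation pt := (point F n).
Local Notation q := #|F|.
Implicit Types (U W X L M N A B : {vspace V}) (P Q R : pt).
Variable S : {set pt}.
Hypothesis evenS : even_type S.

Definition cnt U := #|S :&: points_of U|.

Lemma cntS U W : (U <= W)%VS -> cnt U <= cnt W.
Proof.
move=> UW; apply/subset_leq_card/setIS/subsetP => P; rewrite !in_points_of => PU.
exact: subv_trans UW.
Qed.

Lemma cnt_gt0 U P : P \in S -> (P <= U)%VS -> 0 < cnt U.
Proof. by move=> PS PU; apply/card_gt0P; exists P; rewrite inE PS in_points_of. Qed.

Lemma cnt_gt0P U : 0 < cnt U -> exists2 P, P \in S & (P <= U)%VS.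
Proof. by case/card_gt0P => P; rewrite inE in_points_of => /andP []; exists P. Qed.

Lemma cnt_point P : P \in S -> cnt P = 1.
Proof.
move=> PS; rewrite -(cards1 P); apply: eq_card => Q.
by rewrite inE in_points_of subv_vs_points inE; case: eqP => [->|]; rewrite ?PS ?andbF.
Qed.

Lemma cnt_point0 P : P \notin S -> cnt P = 0.
Proof.
move=> PS; apply: eq_card0 => Q.
by rewrite inE in_points_of subv_vs_points; case: eqP => [->|]; rewrite ?(negbTE PS) ?andbF.
Qed.

Lemma cnt_even L : \dim L = 2 -> ~~ odd (cnt L).
Proof. by move=> dL; apply: evenS; apply/pdimE. Qed.

Lemma cnt_line_ge2 L P : \dim L = 2 -> P \in S -> (P <= L)%VS -> 2 <= cnt L.
Proof. by move=> dL PS PL; have := cnt_even dL; have := cnt_gt0 PS PL; case: (cnt L) => [|[]]. Qed.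

Lemma cnt_pencil U W : (U <= W)%VS ->
  cnt W = cnt U + \sum_(X in ext U W) (cnt X - cnt U).
Proof.
move=> UW; have cD X : (U <= X)%VS -> #|S :&: (points_of X :\: points_of U)| = cnt X - cnt U.
  move=> UX; have XU : points_of X :&: points_of U = points_of U.
    by apply/setIidPr/subsetP => P; rewrite !in_points_of => /subv_trans; apply.
  by rewrite setIDA cardsD -setIA XU.
under eq_bigr => X /extP [UX _ _] do rewrite -cD //.
by rewrite -pencil // cD // subnKC // cntS.
Qed.

Lemma line_ext P L W : (P <= L)%VS -> (L <= W)%VS -> \dim L = 2 -> L \in ext P W.
Proof. by move=> *; apply/extP; split; rewrite ?dim_point. Qed.

(** Each of the [theta F m] lines through [P] carries a second point of [S] by evenness, so no
    difference is truncated; the final sum is the excess at [P]. *)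
Lemma cnt_star P W m : P \in S -> (P <= W)%VS -> \dim W = m.+1 ->
  cnt W = 1 + theta F m + \sum_(L in ext P W) (cnt L - 2).
Proof.
move=> PS PW dW; rewrite (cnt_pencil PW) cnt_point // -addnA; congr (_ + _).
have -> : theta F m = #|ext P W| by rewrite card_ext // dW dim_point subn1.
rewrite -sum1_card -big_split /=.
apply: eq_bigr => L /extP [PL _ dL]; have := cnt_line_ge2 (L := L) _ PS PL.
by rewrite dL dim_point => /(_ erefl); lia.
Qed.

Lemma cnt_star_ge1 P W m L : P \in S -> (P <= L)%VS -> (L <= W)%VS -> \dim L = 2 ->
  \dim W = m.+1 -> 1 + theta F m + (cnt L - 2) <= cnt W.
Proof.
move=> PS PL LW dL dW; rewrite (cnt_star PS (subv_trans PL LW) dW) leq_add2l.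
by rewrite (bigD1 L) /= ?leq_addr // line_ext.
Qed.

Lemma cnt_star_ge2 P W m L M : P \in S -> (P <= L)%VS -> (L <= W)%VS -> \dim L = 2 ->
  (P <= M)%VS -> (M <= W)%VS -> \dim M = 2 -> L <> M ->
  \dim W = m.+1 -> 1 + theta F m + (cnt L - 2) + (cnt M - 2) <= cnt W.
Proof.
move=> PS PL LW dL PM MW dM LM dW; rewrite (cnt_star PS (subv_trans PL LW) dW) -addnA leq_add2l.
rewrite (bigD1 L) /= ?line_ext // leq_add2l (bigD1 M) /= ?leq_addr // line_ext //.
by rewrite eq_sym; apply/eqP.
Qed.

Lemma cnt_star_long P W m : P \in S -> (P <= W)%VS -> \dim W = m.+1 ->
  1 + theta F m < cnt W -> exists L, [/\ (P <= L)%VS, (L <= W)%VS, \dim L = 2 & 2 < cnt L].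
Proof.
move=> PS PW dW; rewrite (cnt_star PS PW dW) -[X in X < _]addn0 ltn_add2l => h.
have [L /andP [LE cL]|h0] := pickP [pred L in ext P W | 2 < cnt L].
  by case/extP: LE => PL LW dL; exists L; split; rewrite // dL dim_point.
rewrite big1 // in h => L LE; have := h0 L; rewrite /= LE /=; lia.
Qed.

Lemma card_line L : \dim L = 2 -> #|points_of L| = q + 1.
Proof. by move=> dL; rewrite card_points dL theta2. Qed.

Lemma cnt_line_le L : \dim L = 2 -> cnt L <= q + 1.
Proof. by move=> dL; rewrite -(card_line dL) subset_leq_card // subsetIr. Qed.

Lemma hole_exists L : \dim L = 2 -> cnt L <= q -> exists2 R, R \notin S & (R <= L)%VS.
Proof.
move=> dL cL; have : 0 < #|points_of L :\: S|.
  by rewrite cardsD setIC card_line // -/(cnt L); lia.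
by case/card_gt0P => R; rewrite inE in_points_of => /andP []; exists R.
Qed.

Lemma hole_unique L P Q : \dim L = 2 -> cnt L = q -> P \notin S -> Q \notin S ->
  (P <= L)%VS -> (Q <= L)%VS -> P = Q.
Proof.
move=> dL cL PS QS PL QL; have : #|points_of L :\: S| <= 1.
  by rewrite cardsD setIC card_line // -/(cnt L); lia.
by move/card_le1_eqP; apply; rewrite inE in_points_of ?PS ?QS.
Qed.

Lemma double_count W (Fam : {set {vspace V}}) (h : {vspace V} -> nat) :
  (forall A, A \in Fam -> (A <= W)%VS) ->
  \sum_(P in S :&: points_of W) \sum_(A in Fam | (P <= A)%VS) h A = \sum_(A in Fam) cnt A * h A.
Proof.
move=> FW; rewrite (exchange_big_dep (mem Fam)) /=; last by move=> P A _ /andP [].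
apply: eq_bigr => A AF; rewrite sum_nat_const; congr (_ * _); apply: eq_card => P.
rewrite [LHS]unfold_in /= AF /= !inE; case: (P \in S) => //=.
by apply/andP/idP => [[] // | PA]; rewrite (subv_trans PA) ?FW.
Qed.

Lemma join_inj N Q P R : \dim N = 2 -> ~~ (Q <= N)%VS -> (P <= N)%VS -> (R <= N)%VS ->
  (P + Q = R + Q)%VS -> P = R.
Proof.
move=> dN QN PN RN e; apply/eqP/negP => /negP PR.
have QP : P != Q by apply: contraNneq QN => <-.
case/negP: QN; rewrite -(line_eq dN PR PN RN) (line_eq (L := P + Q)) ?addvSl ?addvSr ?dim_join //.
by rewrite e addvSl.
Qed.

(* Projecting from Q, the points of N in S and those of L in S lie on disjoint sets of lines through Q. *)
Lemma cnt_two_lines A L N Q : \dim A = 3 -> \dim L = 2 -> \dim N = 2 ->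
  (L <= A)%VS -> (N <= A)%VS -> (Q <= A)%VS -> Q \in S -> ~~ (Q <= L)%VS -> ~~ (Q <= N)%VS ->
  (forall P, P \in S -> (P <= L)%VS -> cnt (P + Q) = 2) ->
  (forall P, P \in S -> (P <= L)%VS -> ~~ (P <= N)%VS) ->
  cnt N + cnt L <= q + 1.
Proof.
move=> dA dL dN LA NA QA QS QL QN short LN.
have dext : #|ext Q A| = q + 1 by rewrite card_ext // dA dim_point theta2.
pose im (M : {vspace V}) := [set (P + Q)%VS | P : pt in S :&: points_of M].
have cim M : \dim M = 2 -> ~~ (Q <= M)%VS -> #|im M| = cnt M.
  move=> dM QM; apply: card_in_imset => P R; rewrite !inE => /andP [_ PM] /andP [_ RM].
  exact: join_inj dM QM PM RM.
rewrite -!cim // -dext -cardsUI.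
have -> : im N :&: im L = set0.
  apply/setP => M; rewrite inE in_set0; apply/andP => - [/imsetP [X]].
  rewrite inE in_points_of => /andP [XS XN] MX /imsetP [P].
  rewrite inE in_points_of => /andP [PS PL] MP.
  have cM : cnt M = 2 by rewrite MP short.
  have PQ : P != Q by apply: contraNneq QL => <-.
  have XQ : X != Q by apply: contraNneq QN => <-.
  have XP : X != P by apply: contraTneq XN => ->; exact: LN.
  suff : #|X |: [set P; Q]| <= cnt M by rewrite cM (cards3 XP XQ PQ).
  apply/subset_leq_card/subsetP => R; rewrite !inE => /or3P [] /eqP ->.
  - by rewrite XS MX addvSl.
  - by rewrite PS MP addvSl.
  - by rewrite QS MP addvSr.
rewrite cards0 addn0; apply/subset_leq_card/subsetP => M; rewrite inE.
have imA B : (B <= A)%VS -> ~~ (Q <= B)%VS -> M \in im B -> M \in ext Q A.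
  move=> BA QB /imsetP [P]; rewrite inE in_points_of => /andP [_ PB] ->.
  rewrite addvC; apply: ext_join => //; first exact: subv_trans PB BA.
  by rewrite subv_vs_points; apply: contraNneq QB => <-.
by case/orP; apply: imA.
Qed.

(** If every line of [A] through the hole [R] met [S], the q lines other than [L] would each carry
    at least two points, against the bound on [cnt A]. *)
Lemma zero_line A L R : \dim A = 3 -> \dim L = 2 -> (R <= L)%VS -> (L <= A)%VS -> R \notin S ->
  cnt A < cnt L + 2 * q -> exists Z, [/\ \dim Z = 2, (R <= Z)%VS, (Z <= A)%VS & cnt Z = 0].
Proof.
move=> dA dL RL LA RS cA.
have [Z /andP [/extP [RZ ZA dZ] cZ]|h0] := pickP [pred Z in ext R A | cnt Z == 0].
  by exists Z; split=> //; [rewrite dZ dim_point | apply/eqP].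
have RA := subv_trans RL LA; move: cA; rewrite (cnt_pencil RA) cnt_point0 // add0n.
have LE : L \in ext R A by exact: line_ext.
rewrite (bigD1 L) //= subn0 ltn_add2l ltnNge; case/negP.
have <- : \sum_(X in ext R A | X != L) 2 = 2 * q.
  rewrite sum_nat_const mulnC; congr (_ * _).
  apply: (@addnI 1); rewrite [RHS]addnC -theta2.
  have <- : #|ext R A| = theta F 2 by rewrite card_ext // dA dim_point.
  rewrite [RHS](cardD1 L) LE; congr (_ + _).
  by apply: eq_card => X; rewrite [LHS]unfold_in [RHS]inE andbC.
apply: leq_sum => X /andP [XE _]; have := h0 X; rewrite /= XE /= subn0.
case/extP: XE => _ _; rewrite dim_point => /cnt_even; case: (cnt X) => [|[]] //.
Qed.

(** * Planes, and long lines through a point of [S] *)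

Definition planes W := [set A | (A <= W)%VS & \dim A == 3].

Lemma planesP W A : reflect ((A <= W)%VS /\ \dim A = 3) (A \in planes W).
Proof. by rewrite inE; apply: (iffP andP) => [] [? /eqP]. Qed.

(** For [P] in [S], these are the lines that contribute to the excess at [P]. *)
Definition long P W := [set L in ext P W | 2 < cnt L].

Lemma longP P W L : reflect [/\ (P <= L)%VS, (L <= W)%VS, \dim L = 2 & 2 < cnt L] (L \in long P W).
Proof.
rewrite inE; apply: (iffP andP) => [[/extP [? ?]]|[? ? ?]]; rewrite ?dim_point //.
by split=> //; apply: line_ext.
Qed.

Lemma cnt_long4 P W m : P \in S -> (P <= W)%VS -> \dim W = m.+1 ->
  (forall L, L \in long P W -> cnt L = 4) -> cnt W = 1 + theta F m + 2 * #|long P W|.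
Proof.
move=> PS PW dW h4; rewrite (cnt_star PS PW dW); congr (_ + _).
rewrite (bigID (fun L => 2 < cnt L)) /= [X in _ + X]big1 ?addn0; last first.
  by move=> L /andP [_]; lia.
rewrite mulnC -sum_nat_const; apply: eq_big => [L|L LE]; first by rewrite [RHS]inE.
by rewrite h4 // inE.
Qed.

(* Two distinct long lines through P span a plane: count ordered pairs of them. *)
Lemma long_pairs P W : (P <= W)%VS -> #|long P W| * (#|long P W| - 1) =
  \sum_(A in planes W | (P <= A)%VS) #|long P A| * (#|long P A| - 1).
Proof.
move=> PW.
have pairs X : #|long P X| * (#|long P X| - 1) =
    \sum_(L in long P X) \sum_(M in long P X | M != L) 1.
  rewrite -sum_nat_const; apply: eq_bigr => L LE; rewrite sum1_card (cardD1 L) LE add1n subn1 /=.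
  by apply: eq_card => M; rewrite [LHS]unfold_in [RHS]inE andbC.
rewrite pairs; under [RHS]eq_bigr => A _ do rewrite pairs.
rewrite [RHS](exchange_big_dep (mem (long P W))) /=; last first.
  move=> A L /andP [/planesP [AW _] _] /longP [PL LA dL cL]; apply/longP; split=> //.
  exact: subv_trans AW.
apply: eq_bigr => L /longP [PL LW dL cL].
rewrite (partition_big (fun M => (L + M)%VS)
  (fun A => (A \in planes W) && (P <= A)%VS && (L \in long P A))) /=; last first.
  move=> M /andP [/longP [PM MW dM cM] ML].
  have LMW : (L + M <= W)%VS by rewrite subv_add LW.
  have PLM : (P <= L + M)%VS by rewrite (subv_trans PL) ?addvSl.
  rewrite PLM andbT; apply/andP; split=> //; last by apply/longP; split; rewrite ?addvSl.
  apply/planesP; split=> //; have [Q QM QL] : exists2 Q : pt, (Q <= M)%VS & ~~ (Q <= L)%VS.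
    by apply: point_notin; apply: contra ML => ML; apply/eqP/eq_dim; rewrite // dL dM.
  have -> : M = (P + Q)%VS.
    by rewrite (line_eq dM) //; apply: contraNneq QL => <-.
  by rewrite addvA (addv_idPl PL) dim_add_point ?dL.
apply: eq_big => [A|A /andP [/andP [/planesP [AW dA] PA] /longP [_ LA _ _]]] //.
apply: eq_bigl => M; apply/andP/andP => [[/andP [/longP [PM MW dM cM] ML] /eqP AE]|].
  by split=> //; apply/longP; split; rewrite // -AE addvSr.
case=> /longP [PM MA dM cM] ML; rewrite ML andbT; split.
  by apply/longP; split=> //; exact: subv_trans AW.
have LM : L <> M by move=> LM; rewrite LM eqxx in ML.
by have [_ _ ->] := meet_lines dA dL dM LA MA LM.
Qed.

Lemma card_planes_through P W : \dim W = 4 -> (P <= W)%VS ->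
  #|[set A in planes W | (P <= A)%VS]| = theta F 3.
Proof.
move=> dW PW; have q0 : 0 < theta F 2 by rewrite theta2 addn1.
apply/eqP; rewrite -(eqn_pmul2r q0); apply/eqP.
(* Count the pairs of a line through [P] and a plane containing it: a plane has q + 1 such lines,
   and a line lies in q + 1 planes of [W]. *)
transitivity (\sum_(A in [set A in planes W | (P <= A)%VS]) \sum_(L in ext P A) 1).
  rewrite -sum_nat_const; apply: eq_bigr => A; rewrite inE => /andP [/planesP [AW dA] PA].
  by rewrite sum1_card card_ext // dA dim_point.
rewrite (exchange_big_dep (mem (ext P W))) /=; last first.
  move=> A L; rewrite inE => /andP [/planesP [AW _] _] /extP [PL LA dL].
  by apply/extP; split=> //; exact: subv_trans AW.
have -> : theta F 3 = #|ext P W| by rewrite card_ext // dW dim_point.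
rewrite -sum_nat_const; apply: eq_bigr => L /extP [PL LW dL]; rewrite sum1_card.
have -> : theta F 2 = #|ext L W| by rewrite card_ext // dW dL dim_point.
apply: eq_card => A; rewrite [LHS]unfold_in /= inE.
apply/andP/extP => [[/andP [/planesP [AW dA] PA] /extP [_ LA _]]|[LA AW dA]].
  by rewrite dA dL dim_point.
split; last by apply/extP.
by rewrite (subv_trans PL LA) andbT; apply/planesP; rewrite dA dL dim_point.
Qed.

End EvenSets.

(** * Solids *)

Section Solids.
Variables (F : finFieldType) (n : nat).
Local Notation V := 'rV[F]_n.+1.
Local Notation pt := (point F n).
Local Notation q := #|F|.
Implicit Types (U W X L M N A B Z : {vspace V}) (P Q R : pt).
Variable S : {set pt}.
Hypothesis evenS : even_type S.
Hypothesis q_even : ~~ odd q.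
Hypothesis q_gt2 : 2 < q.
Local Notation cnt := (cnt S).

(** In the formula of [cnt_star] the part 1 + [theta F m] is even, and so is every [cnt L - 2]. *)
Lemma cnt_star_even W m : \dim W = m.+1 -> odd (theta F m) -> ~~ odd (cnt W).
Proof.
move=> dW om; have [/cnt_gt0P [P PS PW]|] := ltnP 0 (cnt W); last by case: (cnt W).
rewrite (cnt_star evenS PS PW dW) !oddD om /=.
elim/big_ind: _ => // [x y xe ye|L /extP [_ _ dL]]; first by rewrite oddD (negbTE xe).
have := cnt_even evenS (L := L); rewrite dL dim_point => /(_ erefl).
by case: (cnt L) => [|[|k]]; rewrite //= !subSS subn0 negbK.
Qed.

Lemma cnt_plane_even A : \dim A = 3 -> ~~ odd (cnt A).
Proof. by move=> dA; apply: (cnt_star_even dA); rewrite theta2 addn1 /=. Qed.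

Lemma cnt_solid_even W : \dim W = 4 -> ~~ odd (cnt W).
Proof. by move=> dW; apply: (cnt_star_even dW); rewrite theta3 addn1 /= oddD oddX /= (negbTE q_even). Qed.

Lemma cnt_line_le_q L : \dim L = 2 -> cnt L <= q.
Proof.
move=> dL; have := cnt_line_le S dL; have := cnt_even evenS dL; move: q_even; lia.
Qed.

Lemma cnt_plane_ge A P : \dim A = 3 -> P \in S -> (P <= A)%VS -> q + 2 <= cnt A.
Proof. by move=> dA PS PA; rewrite (cnt_star evenS PS PA dA) theta2; lia. Qed.

Lemma cnt_plane_line P A L : P \in S -> (P <= L)%VS -> (L <= A)%VS -> \dim L = 2 -> \dim A = 3 ->
  q + cnt L <= cnt A.
Proof.
move=> PS PL LA dL dA; have := cnt_star_ge1 evenS PS PL LA dL dA.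
by have := cnt_line_ge2 evenS dL PS PL; rewrite theta2; lia.
Qed.

(** The lines of [A] through [P] are among those of [W]; passing to [W] keeps their excess and adds
    q^2 new lines through [P]. *)
Lemma cnt_plane_solid P A W : P \in S -> (P <= A)%VS -> (A <= W)%VS -> \dim A = 3 -> \dim W = 4 ->
  cnt A + q ^ 2 <= cnt W.
Proof.
move=> PS PA AW dA dW; rewrite (cnt_star evenS PS PA dA).
rewrite (cnt_star evenS PS (subv_trans PA AW) dW) theta2 theta3.
suff : \sum_(L in ext P A) (cnt L - 2) <= \sum_(L in ext P W) (cnt L - 2) by lia.
rewrite [X in _ <= X](bigID (mem (ext P A))) /= -[X in X <= _]addn0 leq_add //.
rewrite leq_eqVlt; apply/orP; left; apply/eqP/eq_bigl => L.
apply/idP/andP => [LE|[]] //; split=> //; case/extP: LE => PL LA dL.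
by apply/extP; split=> //; exact: subv_trans AW.
Qed.

Lemma exists_off U (T : {set pt}) : #|S :&: T| < cnt U ->
  exists Q, [/\ Q \in S, (Q <= U)%VS & Q \notin T].
Proof.
move=> h; have /subsetPn [Q] : ~~ (S :&: points_of U \subset T).
  apply: contraL h => sub; rewrite -leqNgt; apply: subset_leq_card.
  by rewrite subsetI subsetIl.
by rewrite inE in_points_of => /andP [QS QU] QT; exists Q.
Qed.

Lemma exists_off_lines U L N : cnt L + cnt N < cnt U ->
  exists Q, [/\ Q \in S, (Q <= U)%VS, ~~ (Q <= L)%VS & ~~ (Q <= N)%VS].
Proof.
move=> h; have [|Q [QS QU]] := @exists_off U (points_of L :|: points_of N).
  by apply: leq_ltn_trans h; rewrite setIUr cardsU leq_subr.
by rewrite inE !in_points_of negb_or => /andP [QL QN]; exists Q.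
Qed.

(** The size q + [cnt L] is the least that [L] allows, so [L] uses up the excess at each of its
    points of [S], and any other line of [A] through such a point is a 2-secant. If [N] has fewer
    than q points, some point of [S] in [A] lies off both lines, and projecting from it gives the
    second bound. *)
Lemma long_in_plane A L N : \dim A = 3 -> \dim L = 2 -> \dim N = 2 ->
  (L <= A)%VS -> (N <= A)%VS -> L <> N -> cnt A = q + cnt L -> 2 < cnt N ->
  (forall P, P \in S -> (P <= L)%VS -> ~~ (P <= N)%VS) /\ (q <= cnt N \/ cnt N + cnt L <= q + 1).
Proof.
move=> dA dL dN LA NA LN cA cN.
have short P M : P \in S -> (P <= L)%VS -> (P <= M)%VS -> (M <= A)%VS -> \dim M = 2 -> L <> M -> cnt M <= 2.
  move=> PS PL PM MA dM LM; have := cnt_star_ge2 evenS PS PL LA dL PM MA dM LM dA.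
  by have := cnt_line_ge2 evenS dL PS PL; rewrite theta2; lia.
have disj P : P \in S -> (P <= L)%VS -> ~~ (P <= N)%VS.
  by move=> PS PL; apply/negP => PN; have := short P N PS PL PN NA dN LN; lia.
split=> //; have [|cAN] := leqP q (cnt N); [by left | right].
have [|Q [QS QA QL QN]] := @exists_off_lines A L N; first by lia.
apply: (cnt_two_lines dA dL dN LA NA QA QS QL QN) => // P PS PL.
have PQ : P != Q by apply: contraNneq QL => <-.
apply/eqP; rewrite eqn_leq (cnt_line_ge2 evenS _ PS) ?dim_join ?addvSl // andbT.
apply: (short P) => //; rewrite ?addvSl ?dim_join //; last by move=> LPQ; rewrite LPQ addvSr in QL.
by rewrite subv_add (subv_trans PL).
Qed.

(** The plane of [L] and [Q] has exactly 2q points: at least as many because of [L], at most because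
    of [W]. Hence a long line [N] of it passes through [Q]. The alternative [cnt N] + q <= q + 1 of
    [long_in_plane] is impossible, so [N] is a q-secant. *)
Lemma q_line_spread W L Q : \dim W = 4 -> cnt W = q ^ 2 + 2 * q -> \dim L = 2 -> (L <= W)%VS ->
  cnt L = q -> Q \in S -> (Q <= W)%VS -> ~~ (Q <= L)%VS ->
  exists N, [/\ \dim N = 2, (Q <= N)%VS, (N <= L + Q)%VS, cnt N = q &
             forall P, P \in S -> (P <= L)%VS -> ~~ (P <= N)%VS].
Proof.
move=> dW cW dL LW cL QS QW QL.
have [P PS PL] : exists2 P, P \in S & (P <= L)%VS by apply: cnt_gt0P; lia.
set A := (L + Q)%VS; have dA : \dim A = 3 by rewrite dim_add_point // dL.
have LA : (L <= A)%VS by rewrite addvSl.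
have AW : (A <= W)%VS by rewrite subv_add LW.
have QA : (Q <= A)%VS by rewrite addvSr.
have cA : cnt A = q + cnt L.
  have := cnt_plane_line PS PL LA dL dA.
  have := cnt_plane_solid PS (subv_trans PL LA) AW dA dW; rewrite cW cL; clear; lia.
have [|N [QN NA dN cN]] := cnt_star_long evenS QS QA dA.
  by rewrite theta2 cA cL; move: q_gt2; clear; lia.
have LN : L <> N by move=> LN; rewrite LN QN in QL.
have [disj cNq] := long_in_plane dA dL dN LA NA LN cA cN.
exists N; split=> //; move: cNq (cnt_line_le_q dN) cN; rewrite cL; clear; lia.
Qed.

Lemma ext_exists U W : (U <= W)%VS -> \dim U < \dim W -> exists X, X \in ext U W.
Proof.
move=> UW dUW; have [P PW PU] : exists2 P : pt, (P <= W)%VS & ~~ (P <= U)%VS.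
  by apply: point_notin; apply/negP => /dimvS; lia.
by exists (U + P)%VS; exact: ext_join.
Qed.

(** This size leaves no excess, so every plane of [W] meets [S] in 0 or q + 2 points. The planes
    through a line missing [S] then make q + 2 a divisor of [cnt W]. *)
Lemma solid_no_cap W P : \dim W = 4 -> P \in S -> (P <= W)%VS -> ~~ (q + 2 %| q ^ 2 + q + 2) ->
  cnt W <> q ^ 2 + q + 2.
Proof.
move=> dW PS PW ndvd cW; case/negP: ndvd; rewrite -cW.
have cA A Q : Q \in S -> (Q <= A)%VS -> (A <= W)%VS -> \dim A = 3 -> cnt A = q + 2.
  move=> QS QA AW dA; have := cnt_plane_ge dA QS QA.
  have := cnt_plane_solid QS QA AW dA dW; rewrite cW; clear; lia.
have [L LE] : exists L, L \in ext P W by apply: ext_exists; rewrite ?dW ?dim_point.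
case/extP: LE => PL LW; rewrite dim_point => dL.
have [A AE] : exists A, A \in ext L W by apply: ext_exists; rewrite ?dW ?dL.
case/extP: AE => LA AW; rewrite dL => dA.
have cL : cnt L <= 2.
  by have := cnt_plane_line PS PL LA dL dA; rewrite (cA A P) ?(subv_trans PL) //; lia.
have [R RS RL] : exists2 R, R \notin S & (R <= L)%VS by apply: hole_exists => //; lia.
have cL2 := cnt_line_ge2 evenS dL PS PL.
have [|Z [dZ RZ ZA cZ]] := zero_line evenS dA dL RL LA RS.
  by rewrite (cA A P) ?(subv_trans PL) //; move: cL2 q_gt2; clear; lia.
rewrite (cnt_pencil S (subv_trans ZA AW)) cZ add0n; apply: dvdn_sum => B /extP [ZB BW].
rewrite dZ subn0 => dB; have [/cnt_gt0P [Q QS QB]|] := ltnP 0 (cnt B); last by case: (cnt B).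
by rewrite (cA B Q).
Qed.

End Solids.

(** * Solids for q = 8 *)

Section SolidsEight.
Variables (F : finFieldType) (n : nat).
Local Notation V := 'rV[F]_n.+1.
Local Notation pt := (point F n).
Implicit Types (U X L M N A B Z : {vspace V}) (P Q R : pt).
Variable S : {set pt}.
Hypothesis evenS : even_type S.
Hypothesis q8 : #|F| = 8.
Local Notation cnt := (cnt S).

Let q_even : ~~ odd #|F|. Proof. by rewrite q8. Qed.
Let q_gt2 : 2 < #|F|. Proof. by rewrite q8. Qed.
Let theta2_8 : theta F 2 = 9. Proof. by rewrite theta2 q8. Qed.
Let theta3_8 : theta F 3 = 73. Proof. by rewrite theta3 q8. Qed.

(** If a plane through [L] has 14 points, a long line of it through a point of [S] off [L] has 4 or
    6 points, which contradicts both alternatives of [long_in_plane]. Otherwise the nine planes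
    through [L] have at least 16 points each, and 6 + 9 * 10 exceeds 80. *)
Lemma solid_no_6line W P L : \dim W = 4 -> cnt W <= 80 -> P \in S -> (P <= L)%VS -> (L <= W)%VS ->
  \dim L = 2 -> cnt L <> 6.
Proof.
move=> dW cW PS PL LW dL cL.
have [A /andP [/extP [LA AW]]|h0] := pickP [pred A in ext L W | cnt A == 14].
  rewrite dL => dA /eqP cA.
  have [|X [XS XA]] := @exists_off _ _ S A (points_of L); first by rewrite -/(cnt L) cL cA.
  rewrite in_points_of => XL; have [|N [XN NA dN cN]] := cnt_star_long evenS XS XA dA.
    by rewrite theta2_8 cA.
  have LN : L <> N by move=> LN; rewrite LN XN in XL.
  have := cnt_star_ge1 evenS XS XN NA dN dA; have := cnt_even evenS dN.
  have [|_] := long_in_plane evenS q_even q_gt2 dA dL dN LA NA LN _ cN; first by rewrite cA cL q8.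
  by move: cN; rewrite theta2_8 q8 cA cL; clear; lia.
suff : 9 * 10 <= \sum_(A in ext L W) (cnt A - 6).
  move=> h; rewrite (cnt_pencil S LW) cL in cW.
  by have : 6 + 9 * 10 <= 80 by apply: leq_trans cW; rewrite leq_add2l.
have -> : 9 * 10 = \sum_(A in ext L W) 10 by rewrite sum_nat_const card_ext // dW dL theta2_8.
apply: leq_sum => A AE; have := h0 A; rewrite /= AE /=.
case/extP: AE => LA AW; rewrite dL => dA.
have := cnt_plane_line evenS q_even q_gt2 PS PL LA dL dA; have := cnt_plane_even evenS q_even dA.
rewrite q8 cL; lia.
Qed.

(** * Solids in which every long line is a 4-secant *)

Section AllLongFour.
Variable W : {vspace V}.
Hypothesis dW : \dim W = 4.
Hypothesis long4 : forall P L, P \in S -> L \in long S P W -> cnt L = 4.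
Variable k : nat.
Hypothesis cW : cnt W = 74 + 2 * k.

(** The number 74 is 1 + [theta F 3], the size without excess, and each 4-secant through [P] adds
    2. *)
Lemma card_long P : P \in S -> (P <= W)%VS -> #|long S P W| = k.
Proof.
move=> PS PW; have := cnt_long4 evenS PS PW dW (fun L => @long4 P L PS).
by rewrite cW theta3_8; lia.
Qed.

Lemma long_sub P A : (A <= W)%VS -> long S P A \subset long S P W.
Proof.
move=> AW; apply/subsetP => L /longP [PL LA dL cL]; apply/longP; split=> //.
exact: subv_trans AW.
Qed.

Lemma cnt_plane_long P A : P \in S -> (P <= A)%VS -> A \in planes W ->
  cnt A = 10 + 2 * #|long S P A| /\ #|long S P A| <= k.
Proof.
move=> PS PA /planesP [AW dA]; split; last first.
  by rewrite -(card_long PS (subv_trans PA AW)) subset_leq_card // long_sub.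
rewrite (cnt_long4 evenS PS PA dA) ?theta2_8 // => L LE; apply: (long4 PS).
exact: subsetP (long_sub P AW) L LE.
Qed.

Lemma cnt_plane_values A : A \in planes W -> cnt A = 0 \/ exists2 j, j <= k & cnt A = 10 + 2 * j.
Proof.
move=> AW; have [/cnt_gt0P [P PS PA]|] := ltnP 0 (cnt A); last by left; lia.
by right; have [cA jk] := cnt_plane_long PS PA AW; exists #|long S P A|.
Qed.

(** A plane with 10 + 2j points has j long lines through each of its points of [S], and this is the
    number j (j - 1) of ordered pairs of them. Truncated subtraction gives 0 for a plane missing
    [S]. *)
Definition pairs A := (cnt A - 10)./2 * ((cnt A - 10)./2 - 1).

Lemma point_pairs P : P \in S -> (P <= W)%VS ->
  k * (k - 1) = \sum_(A in planes W | (P <= A)%VS) pairs A.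
Proof.
move=> PS PW; rewrite -(card_long PS PW) long_pairs //; apply: eq_bigr => A /andP [AW PA].
have [cA _] := cnt_plane_long PS PA AW; rewrite /pairs cA addKn mul2n doubleK //.
Qed.

Lemma all_pairs : cnt W * (k * (k - 1)) = \sum_(A in planes W) cnt A * pairs A.
Proof.
rewrite -(@double_count F n S W); last by move=> A /planesP [].
rewrite -sum_nat_const; apply: eq_bigr => P; rewrite inE in_points_of => /andP [PS PW].
exact: point_pairs.
Qed.

(** Of the 73 planes through a point of [S], nine contain its only 4-secant and the other 64 have
    exactly 10 points. Counting incidences would give 76 * 64 as a multiple of 10. *)
Lemma long4_neq1 : k <> 1.
Proof.
move=> k1; pose Fam := [set A in planes W | cnt A == 10].
suff : cnt W * 64 = #|Fam| * 10 by rewrite cW k1; lia.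
transitivity (\sum_(A in Fam) cnt A * 1); last first.
  rewrite -sum_nat_const; apply: eq_bigr => A; rewrite inE => /andP [_ /eqP ->]; lia.
rewrite -(@double_count F n S W); last by move=> A; rewrite inE => /andP [/planesP []].
rewrite -sum_nat_const; apply: eq_bigr => P; rewrite inE in_points_of => /andP [PS PW].
rewrite sum1_card.
have /cards1P [L LE] : #|long S P W| == 1 by rewrite card_long // k1.
have /longP [PL LW dL cL] : L \in long S P W by rewrite LE set11.
have h73 := card_planes_through dW PW; have h9 : #|ext L W| = 9 by rewrite card_ext // dW dL theta2_8.
rewrite theta3_8 -(cardsID (ext L W)) in h73.
have e1 : [set A in planes W | (P <= A)%VS] :&: ext L W = ext L W.
  apply/setIidPr/subsetP => A /extP [LA AW dA]; rewrite inE (subv_trans PL LA) andbT.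
  by apply/planesP; rewrite dA dL.
rewrite e1 h9 in h73; apply/esym/(@addnI 9); rewrite -[RHS]/73 -h73; congr (9 + _).
apply: eq_card => A; rewrite [LHS]unfold_in /= in_setD /Fam ![A \in [set X in planes W | _]]inE.
have [AW|] := boolP (A \in planes W); last by rewrite andbF.
have [PA|] := boolP (P <= A)%VS; last by rewrite !andbF.
have [AW' dA] := planesP _ _ AW.
rewrite !andbT; have [-> _] := cnt_plane_long PS PA AW.
have -> : (10 + 2 * #|long S P A| == 10) = (long S P A == set0) by rewrite -cards_eq0; clear; lia.
apply/eqP/idP => [A0|].
  apply/extP => [[LA _ _]]; suff : L \in long S P A by rewrite A0 inE.
  by apply/longP.
move=> nA; apply/setP => M; rewrite [RHS]inE; apply/negP => MA.
have := subsetP (long_sub P AW') _ MA; rewrite LE inE => /eqP ML.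
case/negP: nA; case/longP: MA => _ MA _ _; apply/extP; rewrite -ML; split=> //.
by rewrite dA ML dL.
Qed.

(** In [all_pairs] only planes with 14 points contribute, each 14 * 2 = 28, but the total 78 * 2 is
    not a multiple of 28. *)
Lemma long4_neq2 : k <> 2.
Proof.
move=> k2; suff : 28 %| cnt W * (k * (k - 1)) by rewrite cW k2.
rewrite all_pairs; apply: dvdn_sum => A AW.
have [c|[j jk c]] := cnt_plane_values AW; rewrite /pairs c //.
by move: jk; rewrite k2; case: j c => [|[|[|]]].
Qed.

(** * Three 4-secants through every point *)

Section KThree.
Hypothesis k3 : k = 3.

Definition planes16 := [set A in planes W | cnt A == 16].

Lemma planes16P A : reflect [/\ (A <= W)%VS, \dim A = 3 & cnt A = 16] (A \in planes16).
Proof.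
rewrite inE; apply: (iffP andP) => [[/planesP [AW dA] /eqP]|[AW dA cA]] //.
by split; [exact/planesP|exact/eqP].
Qed.

Lemma cnt_plane_values3 A : A \in planes W -> [\/ cnt A <= 12, cnt A = 14 | cnt A = 16].
Proof.
case/cnt_plane_values => [->|[j]]; first by constructor 1.
by rewrite k3 => jk ->; case: j jk => [|[|[|[|]]]] // _; [constructor 1|constructor 1|constructor 2|constructor 3].
Qed.

Lemma pairs_small A : cnt A <= 12 -> pairs A = 0.
Proof.
move=> c; rewrite /pairs; have : (cnt A - 10)./2 <= 1 by lia.
by case: (_./2) => [|[|]].
Qed.

(** By [all_pairs], 480 = 28a + 96b, where a planes have 14 and b planes have 16 points. The only
    solution in natural numbers is a = 0, b = 5. *)
Lemma planes_count : #|planes16| = 5 /\ forall A, A \in planes W -> cnt A <> 14.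
Proof.
set p14 := [set A in planes W | cnt A == 14].
have : 480 = 28 * #|p14| + 96 * #|planes16|.
  have -> : 480 = cnt W * (k * (k - 1)) by rewrite cW k3.
  rewrite all_pairs (eq_bigr (fun A => 28 * (cnt A == 14) + 96 * (cnt A == 16))); last first.
    move=> A /cnt_plane_values3 [c|c|c]; last 2 first.
    - by rewrite /pairs c.
    - by rewrite /pairs c.
    by rewrite pairs_small // muln0; case: eqP => [h|_]; [rewrite h in c|case: eqP => [h|//]; rewrite h in c].
  rewrite big_split /= -!big_distrr /=; congr (28 * _ + 96 * _);
    rewrite -sum1_card -big_mkcondr /=; apply: eq_bigl => A; by rewrite [RHS]inE.
move=> h; have h0 : #|p14| = 0 /\ #|planes16| = 5 by lia.
split=> [|A AW cA]; first by case: h0.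
by case: h0 => /eqP; rewrite cards_eq0 => /eqP /setP /(_ A); rewrite in_set0 /p14 inE AW cA.
Qed.

Lemma planes_values A : A \in planes W -> [\/ cnt A = 0, cnt A = 10, cnt A = 12 | cnt A = 16].
Proof.
move=> AW; have [_ n14] := planes_count; have := n14 _ AW.
have [->|[j]] := cnt_plane_values AW; first by constructor 1.
rewrite k3 => jk ->; case: j jk => [|[|[|[|]]]] // _ _.
- by constructor 2.
- by constructor 3.
- by constructor 4.
Qed.

(** The six ordered pairs of 4-secants at [P] lie in planes with nonzero [pairs], and only those
    with 16 points remain. *)
Lemma planes16_cover P : P \in S -> (P <= W)%VS -> exists2 A, A \in planes16 & (P <= A)%VS.
Proof.
move=> PS PW; have [A /andP [A16 PA]|h0] := pickP [pred A in planes16 | (P <= A)%VS].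
  by exists A.
have := point_pairs PS PW; rewrite k3 big1 // => A /andP [AW PA].
have := h0 A; rewrite /= [_ \in _]inE AW PA andbT /= => c16; apply: pairs_small.
by move: c16; have [] := planes_values AW => ->.
Qed.

(** A plane with 10 points has no long line through its points of [S], so each 16-point plane
    contains at most two of them. As the five 16-point planes cover all ten, none of them can
    contain none. *)
Lemma plane10_meets A B : A \in planes W -> cnt A = 10 -> B \in planes16 -> cnt (A :&: B)%VS <> 0.
Proof.
move=> AP cA BE; have [AW dA] := planesP _ _ AP.
have le2 C : C \in planes16 -> cnt (A :&: C)%VS <= 2.
  case/planes16P => CW dC cC; have dAC : \dim (A :&: C)%VS = 2.
    by apply: meet_planes dW dA dC AW CW _ => eAC; move: cA; rewrite eAC cC.
  rewrite leqNgt; apply/negP => c2.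
  have [P PS PAC] : exists2 P, P \in S & (P <= A :&: C)%VS by apply: cnt_gt0P; lia.
  have PA : (P <= A)%VS by apply: subv_trans PAC (capvSl _ _).
  have := cnt_plane_line evenS q_even q_gt2 PS PAC (capvSl A C) dAC dA.
  by have := cnt_even evenS dAC; move: c2; rewrite cA q8; clear; lia.
have le : cnt A <= \sum_(C in planes16) cnt (A :&: C)%VS.
  apply: (@leq_trans (\sum_(P in S :&: points_of A) \sum_(C in planes16 | (P <= C)%VS) 1)).
    rewrite -[cnt A]sum1_card; apply: leq_sum => P; rewrite inE in_points_of => /andP [PS PA].
    have [C CE PC] := planes16_cover PS (subv_trans PA AW).
    by rewrite (bigD1 C) //= CE.
  rewrite (exchange_big_dep (mem planes16)) /=; last by move=> P C _ /andP [].
  apply: leq_sum => C CE; rewrite sum1_card subset_leq_card //.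
  apply/subsetP => P; rewrite [_ \in _]unfold_in /= CE !in_setI !in_points_of => /andP [/andP [-> PA] PC].
  by rewrite subv_cap PA.
move=> c0; move: le; rewrite cA (bigD1 B) //= c0 add0n leqNgt; case/negP.
apply: (@leq_ltn_trans (\sum_(C in planes16 | C != B) 2)).
  by apply: leq_sum => C /andP [CE _]; apply: le2.
have [c5 _] := planes_count; rewrite (cardsD1 B) BE in c5.
rewrite (eq_bigl (mem (planes16 :\ B))) => [|C]; last by rewrite /= in_setD1 andbC.
by rewrite sum_nat_const; lia.
Qed.

(** The other planes of [W] through [Z] carry 80 - 16 = 64 points. None has exactly 10, since it
    would meet [B] in the zero line [Z]; if none had 16 either, 12 would divide 64. *)
Lemma zero_line_other B Z : B \in planes16 -> (Z <= B)%VS -> \dim Z = 2 -> cnt Z = 0 ->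
  exists C, [/\ C \in planes16, C != B & (Z <= C)%VS].
Proof.
move=> BE ZB dZ cZ; have [C /and3P [] |h0] := pickP [pred C | [&& C \in planes16, C != B & (Z <= C)%VS]].
  by exists C.
have [BW dB cB] := planes16P _ BE; have ZW := subv_trans ZB BW.
have BX : B \in ext Z W by apply/extP; rewrite dZ.
have := cnt_pencil S ZW; rewrite cZ cW k3 (bigD1 B) //= cB => h.
suff : 12 %| 64 by [].
have -> : 64 = \sum_(i in ext Z W | i != B) (cnt i - 0) by move: h; set s := \sum_(_ in _ | _) _; lia.
apply: dvdn_sum => C /andP [/extP [ZC CW]]; rewrite dZ subn0 => dC CB.
have CP : C \in planes W by apply/planesP.
have [|c|->|c] // := planes_values CP; first by move=> ->.
  case: (plane10_meets CP c BE); have -> : (C :&: B)%VS = Z; last by [].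
  apply/esym/eq_dim; first by rewrite subv_cap ZC.
  by rewrite dZ (meet_planes dW dC dB CW BW) //; apply/eqP.
have := h0 C; rewrite /= CB ZC /= andbT => /negbT /negP []; exact/planes16P.
Qed.

(* The five holes of a 4-line in a plane B with 16 points lie on five different zero lines of B,
   each of which is the trace on B of one of the only four other such planes. *)
Lemma long4_neq3 : False.
Proof.
have [c5 _] := planes_count.
have [B BE] : exists B, B \in planes16 by apply/card_gt0P; rewrite c5.
have [BW dB cB] := planes16P _ BE.
have [P PS PB] : exists2 P, P \in S & (P <= B)%VS by apply: cnt_gt0P; rewrite cB.
have [|L [PL LB dL cL]] := cnt_star_long evenS PS PB dB; first by rewrite theta2_8 cB.
have cL4 : cnt L = 4.
  by apply: (long4 PS); apply/longP; split=> //; exact: subv_trans BW.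
pose r R C := (R <= C)%VS && (cnt (C :&: B)%VS == 0).
have c5' : #|points_of L :\: S| = 5.
  by rewrite cardsD setIC card_line // q8 -/(cnt L) cL4.
have : 5 <= \sum_(R in points_of L :\: S) \sum_(C in planes16 :\ B | r R C) 1.
  rewrite -c5' -sum1_card; apply: leq_sum => R; rewrite inE in_points_of => /andP [RS RL].
  have [|Z [dZ RZ ZB cZ]] := zero_line evenS dB dL RL LB RS; first by rewrite cB cL4 q8.
  have [C [CE CB ZC]] := zero_line_other BE ZB dZ cZ.
  have [CW dC cC] := planes16P _ CE.
  rewrite (bigD1 C) //= in_setD1 CB CE /=.
  rewrite /r (subv_trans RZ ZC) /=; have -> : (C :&: B)%VS = Z; last by rewrite cZ.
  apply/esym/eq_dim; first by rewrite subv_cap ZC.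
  by rewrite dZ (meet_planes dW dC dB CW BW) //; apply/eqP.
rewrite (exchange_big_dep (mem (planes16 :\ B))) /=; last by move=> R C _ /andP [].
apply/negP; rewrite -ltnNge; apply: (@leq_ltn_trans (\sum_(C in planes16 :\ B) 1)); last first.
  by rewrite sum1_card; move: c5; rewrite (cardsD1 B) BE; lia.
apply: leq_sum => C; rewrite in_setD1 => /andP [CB CE]; rewrite sum1_card.
apply/card_le1_eqP => R R' /andP [RE /andP [_ /andP [RC /eqP c0]]] /andP [RE' /andP [_ /andP [R'C _]]].
move: RE RE'; rewrite !in_setD !in_points_of => /andP [_ RL] /andP [_ R'L].
(* Two holes on the same [C] would put [L], with its four points of [S], into [C :&: B], which
   misses [S]. *)
apply/esym/eqP/negP => /negP RR'; have LC : (L <= C)%VS.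
  by rewrite -(line_eq dL RR' RL R'L) subv_add RC.
have : cnt L <= cnt (C :&: B)%VS by apply: cntS; rewrite subv_cap LC.
by rewrite c0 cL4.
Qed.

End KThree.
End AllLongFour.

Lemma solid_eight W P : \dim W = 4 -> P \in S -> (P <= W)%VS -> cnt W <= 80 ->
  cnt W = 80 /\ exists L, [/\ \dim L = 2, (P <= L)%VS, (L <= W)%VS & cnt L = 8].
Proof.
move=> dW PS PW cW.
(* The excess at a point is at most 6, so a long line has 4, 6 or 8 points; 6 is excluded, and 8
   uses up the whole bound. *)
have longs Q L : Q \in S -> L \in long S Q W -> cnt L = 4 \/ cnt L = 8 /\ cnt W = 80.
  move=> QS /longP [QL LW dL cL]; have := cnt_star_ge1 evenS QS QL LW dL dW.
  have := solid_no_6line dW cW QS QL LW dL; have := cnt_even evenS dL; rewrite theta3_8; lia.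
have [L /and3P [LW /eqP dL /eqP cL]|h0] := pickP [pred L | [&& (L <= W)%VS, \dim L == 2 & cnt L == 8]].
  have [Q QS QL] : exists2 Q, Q \in S & (Q <= L)%VS by apply: cnt_gt0P; rewrite cL.
  have [|c4|[_ c80]] := longs Q L QS; first by apply/longP; split; rewrite ?cL.
    by rewrite c4 in cL.
  split=> //; have [PL|PL] := boolP (P <= L)%VS; first by exists L.
  have [N [dN PN NLP cN _]] : exists N, [/\ \dim N = 2, (P <= N)%VS, (N <= L + P)%VS, cnt N = #|F| &
             forall R, R \in S -> (R <= L)%VS -> ~~ (R <= N)%VS].
    by apply: (q_line_spread evenS q_even q_gt2 dW) => //; rewrite ?q8.
  exists N; split; rewrite -?q8 //; apply: subv_trans NLP _; by rewrite subv_add LW.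
(* Without 8-secants every long line is a 4-secant, and each possible number of them through [P],
   from 0 to 3, is refuted. *)
have long4 Q L : Q \in S -> L \in long S Q W -> cnt L = 4.
  move=> QS LE; have [//|[c8 _]] := longs Q L QS LE.
  by case/longP: LE => _ LW dL _; have := h0 L; rewrite /= LW dL c8.
have := cnt_long4 evenS PS PW dW (fun L => @long4 P L PS); rewrite theta3_8.
set k := #|_| => cWk.
have k_le : k <= 3 by lia.
have [] : [\/ k = 0, k = 1, k = 2 | k = 3].
  by case: (k) k_le => [|[|[|[|]]]] // _; [constructor 1|constructor 2|constructor 3|constructor 4].
- move=> k0; case: (solid_no_cap evenS q_even q_gt2 dW PS PW); first by rewrite q8.
  by rewrite q8 cWk k0.
- by move/(long4_neq1 dW long4 cWk).
- by move/(long4_neq2 dW long4 cWk).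
- by move/(long4_neq3 dW long4 cWk).
Qed.

End SolidsEight.

(** For q = 4 the size is even and between 22 and 24. The value 22 is excluded as 6 does not divide
    it, and with 24 points a long line through [P] must have four points. *)
Lemma solid_four_or_eight (F : finFieldType) (n : nat) (S : {set point F n}) (evenS : even_type S)
    (W : {vspace 'rV[F]_n.+1}) (P : point F n) (q48 : #|F| = 4 \/ #|F| = 8) :
  \dim W = 4 -> P \in S -> (P <= W)%VS -> cnt S W <= #|F| ^ 2 + 2 * #|F| ->
  cnt S W = #|F| ^ 2 + 2 * #|F| /\
  exists L, [/\ \dim L = 2, (P <= L)%VS, (L <= W)%VS & cnt S L = #|F|].
Proof.
case: q48 => q48 dW PS PW; last first.
  by have := @solid_eight F n S evenS q48 W P dW PS PW; rewrite q48.
have q_even : ~~ odd #|F| by rewrite q48.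
have q_gt2 : 2 < #|F| by rewrite q48.
rewrite q48 => cW; have ndvd : ~~ (#|F| + 2 %| #|F| ^ 2 + #|F| + 2) by rewrite q48.
have := solid_no_cap evenS q_even q_gt2 dW PS PW ndvd.
have := cnt_solid_even evenS q_even dW; have := cnt_star evenS PS PW dW.
rewrite theta3 q48 => c e ne; have c24 : cnt S W = 24 by lia.
split=> //; have [|L [PL LW dL cL]] := cnt_star_long evenS PS PW dW; first by rewrite theta3 q48 c24.
exists L; split=> //; have := cnt_even evenS dL; have := cnt_line_le_q evenS q_even q_gt2 dL.
by rewrite q48; lia.
Qed.

(** * Cylinders *)

Section Cylinder.
Variables (F : finFieldType) (m : nat).
Local Notation n := m.+2.
Local Notation V := 'rV[F]_n.+1.
Local Notation pt := (point F n).
Local Notation q := #|F|.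
Implicit Types (U W T L M N A B Z : {vspace V}) (P Q R X Y H : pt).
Variable S : {set pt}.
Hypothesis evenS : even_type S.
Hypothesis q48 : q = 4 \/ q = 8.
Hypothesis cardS : #|S| = q ^ m * (q + 2).
Local Notation cnt := (cnt S).

Let q_even : ~~ odd q. Proof. by case: q48 => ->. Qed.
Let q_gt2 : 2 < q. Proof. by case: q48 => ->. Qed.

Lemma dim_full : \dim (fullv : {vspace V}) = m + 3.
Proof. by rewrite dimvf /dim /= mul1n addn3. Qed.

Lemma cnt_full : cnt fullv = q ^ m * (q + 2).
Proof. by rewrite -cardS; apply: eq_card => P; rewrite inE in_points_of subvf andbT. Qed.

(** Otherwise, by parity, every plane through the 2-secant has at least q + 4 points. There are at
    least q^m such planes, so together they would add at least q^m (q + 2) points to the two on the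
    line, more than [S] has. *)
Lemma hyperoval_plane P X : P \in S -> X \in S -> P != X -> cnt (P + X) = 2 ->
  exists T, [/\ (P <= T)%VS, (X <= T)%VS, \dim T = 3 & cnt T = q + 2].
Proof.
move=> PS XS PX cPX; set L := (P + X)%VS in cPX *.
have dL : \dim L = 2 by exact: dim_join.
have PL : (P <= L)%VS by rewrite addvSl.
have [T /andP [/extP [LT _ dT] /eqP cT]|h0] := pickP [pred T in ext L fullv | cnt T == q + 2].
  exists T; split; rewrite ?dT ?dL //; first exact: subv_trans LT.
  by rewrite (subv_trans _ LT) // addvSr.
have := cnt_pencil S (subvf L); rewrite cnt_full cPX.
have : \sum_(T in ext L fullv) (q + 2) <= \sum_(T in ext L fullv) (cnt T - 2).
  apply: leq_sum => T TE; have := h0 T; rewrite /= TE /= => /eqP ne.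
  case/extP: TE => LT _; rewrite dL => dT.
  have := cnt_plane_ge evenS q_even q_gt2 dT PS (subv_trans PL LT).
  have := cnt_plane_even evenS q_even dT; move: q_even ne; set c := cnt T; set f := #|F|; clear; lia.
rewrite sum_nat_const card_ext ?subvf // dim_full dL (_ : m + 3 - 2 = m.+1); last by clear; lia.
rewrite theta_S => h1 h2; exfalso; move: h1; have := q_gt2; set s := \sum_(_ in _) _ in h2 *; move: h2; set x := q ^ m; set y := theta F m; nia.
Qed.

(** Every solid through [T] has at least (q + 2)(q - 1) points of [S] outside [T]. Over all
    [theta F m] solids this makes (q + 2)(q^m - 1), which together with [T] is already all of [S];
    so equality holds in each solid. *)
Lemma hyperoval_solid T W P : \dim T = 3 -> cnt T = q + 2 -> P \in S -> (P <= T)%VS ->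
  W \in ext T fullv -> cnt W = q ^ 2 + 2 * q.
Proof.
move=> dT cT PS PT WE.
have ge U : U \in ext T fullv -> q ^ 2 + 2 * q <= cnt U.
  case/extP => TU _; rewrite dT => dU; have [//|lt] := leqP (q ^ 2 + 2 * q) (cnt U).
  have [|e _] := solid_four_or_eight evenS q48 dU PS (subv_trans PT TU); first exact: ltnW.
  by rewrite e ltnn in lt.
have := cnt_pencil S (subvf T); rewrite cnt_full cT.
have -> : \sum_(U in ext T fullv) (cnt U - (q + 2)) =
   \sum_(U in ext T fullv) (cnt U - (q ^ 2 + 2 * q)) + \sum_(U in ext T fullv) (q + 2) * (q - 1).
  rewrite -big_split; apply: eq_bigr => U /ge; rewrite /=; set c := cnt U.
  by case: q48 => ->; lia.
rewrite sum_nat_const card_ext ?subvf // dim_full dT addnK mulnCA [_ * (q - 1)]mulnC theta_geo.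
have x0 : 0 < q ^ m by rewrite expn_gt0; case: q48 => ->.
rewrite (bigD1 W) //=; set s := \sum_(_ in _ | _) _ => h.
have := ge _ WE; move: h x0; set x := q ^ m; case: q48 => ->; lia.
Qed.

(** * Pairs of points of [S] joined by a 2-secant *)

Definition bad P := [set X in S | (X != P) && (cnt (P + X) != 2)].

Lemma in_bad P X : (X \in bad P) = [&& X \in S, X != P & cnt (P + X) != 2].
Proof. by rewrite inE. Qed.

(** A long line [L] through [P] holds [cnt L - 1] bad points, at most twice its excess, and the
    total excess at [P] is q^m - 1 - [theta F m]. *)
Lemma card_bad P : P \in S -> #|bad P| <= 2 * (q ^ m - 1).
Proof.
move=> PS; have dF : \dim (fullv : {vspace V}) = m.+2.+1 by rewrite dim_full addn3.
have := cnt_star evenS PS (subvf P) dF; rewrite cnt_full !theta_S.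
have : #|bad P| <= 2 * \sum_(L in ext P fullv) (cnt L - 2).
  have := pencil (bad P) (subvf P).
  rewrite (_ : bad P :&: _ = bad P); last first.
    apply/setIidPl/subsetP => X; rewrite !inE subvf andbT => /and3P [_ XP _].
    by rewrite subv_vs_points.
  move=> ->; rewrite big_distrr; apply: leq_sum => L /extP [PL _]; rewrite dim_point => dL /=.
  have c2 := cnt_line_ge2 evenS dL PS PL.
  have [c2'|cL] := eqVneq (cnt L) 2.
    rewrite c2' leqn0 cards_eq0; apply/eqP/setP => X; rewrite !inE.
    apply/negP => /and3P [/and3P [_ XP cX] _ XL].
    by move: cX; rewrite (line_eq dL) ?c2' // eq_sym.
  apply: (@leq_trans (cnt L - 1)); last by lia.
  apply: (@leq_trans #|(S :&: points_of L) :\: (S :&: points_of P)|).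
    apply/subset_leq_card/subsetP => X; rewrite !inE => /and3P [/and3P [-> _ _] XnP ->].
    by rewrite (negbTE XnP) andbF.
  have SP : (S :&: points_of L) :&: (S :&: points_of P) = S :&: points_of P.
    by apply/setIidPr/setIS/subsetP => X; rewrite !in_points_of => /subv_trans; apply.
  by rewrite cardsD SP -/(cnt L) -/(cnt P) cnt_point.
rewrite expnS; set s := \sum_(_ in _) _; set x := q ^ m; set y := theta F m; nia.
Qed.

(** At most 2 + 4 (q^m - 1) points are excluded, while [S] has at least 6 q^m. The case P = Q is
    included. *)
Lemma common_secant P Q : P \in S -> Q \in S ->
  exists X, [/\ X \in S, X != P, X != Q, cnt (P + X) = 2 & cnt (Q + X) = 2].
Proof.
move=> PS QS; have [|X [XS _]] := @exists_off F n S fullv ((P |: bad P) :|: (Q |: bad Q)).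
  apply: (@leq_ltn_trans #|(P |: bad P) :|: (Q |: bad Q)|); first by rewrite subset_leq_card ?subsetIr.
  have := card_bad PS; have := card_bad QS; rewrite cnt_full cardsU !cardsU1.
  have x0 : 0 < q ^ m by rewrite expn_gt0; case: q48 => ->.
  move: x0; set x := q ^ m; have : x * 6 <= x * (q + 2) by rewrite leq_mul2l; case: q48 => ->; rewrite orbT.
  set y := x * _; set a := #|bad P|; set b := #|bad Q|; set i := #|_ :&: _|.
  by case: (_ \notin _); case: (_ \notin _); clear; rewrite /=; lia.
have secant R : X \notin R |: bad R -> X != R /\ cnt (R + X) = 2.
  by rewrite in_setU1 negb_or in_bad XS => /andP [XR]; rewrite XR negbK => /eqP.
by rewrite in_setU negb_or => /andP [/secant [XP cP] /secant [XQ cQ]]; exists X.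
Qed.

(** In the solid spanned by [H] and a hyperoval plane through [P] and [X], [q_line_spread] gives a
    q-secant [N] through [X] in the plane of [X] and [P + H]. The two q-secants meet outside [S],
    hence in [H], the only hole of [P + H]. *)
Lemma vertex_secant P H X : P \in S -> H \notin S -> cnt (P + H) = q -> X \in S -> X != P ->
  cnt (P + X) = 2 -> cnt (X + H) = q.
Proof.
move=> PS HS cL XS XP cPX; have PX : P != X by rewrite eq_sym.
have PH : P != H by apply: contraNneq HS => <-.
have [T [PT XT dT cT]] := hyperoval_plane PS XS PX cPX.
set L := (P + H)%VS in cL; have dL : \dim L = 2 by exact: dim_join.
have PL : (P <= L)%VS by rewrite addvSl.
have HL : (H <= L)%VS by rewrite addvSr.
have HT : ~~ (H <= T)%VS.
  apply/negP => HT; have LT : (L <= T)%VS by rewrite subv_add PT.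
  have := cnt_plane_line evenS q_even q_gt2 PS PL LT dL dT; by rewrite cL cT leq_add2l leqNgt q_gt2.
set W := (T + H)%VS; have WE : W \in ext T fullv by rewrite ext_join ?subvf.
have cW := hyperoval_solid dT cT PS PT WE.
have dW : \dim W = 4 by rewrite dim_add_point // dT.
have TW : (T <= W)%VS by rewrite addvSl.
have LW : (L <= W)%VS by rewrite subv_add (subv_trans PT) //= addvSr.
have XL : ~~ (X <= L)%VS.
  by apply/negP => XL; move: cPX; rewrite (line_eq dL) // cL => q2; have := q_gt2; rewrite q2.
have [N [dN XN NLX cN disj]] := q_line_spread evenS q_even q_gt2 dW cW dL LW cL XS (subv_trans XT TW) XL.
have dA : \dim (L + X) = 3 by rewrite dim_add_point // dL.
have LN : L <> N by move=> LN; rewrite LN XN in XL.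
have [R RE _] := meet_lines dA dL dN (addvSl L X) NLX LN.
have RL : (R <= L)%VS by rewrite -RE capvSl.
have RN : (R <= N)%VS by rewrite -RE capvSr.
have RS : R \notin S by apply/negP => RS; have := disj R RS RL; rewrite RN.
have RH : R = H by apply: hole_unique dL cL RS HS RL HL.
have XH : X != H by apply: contraNneq HS => <-.
have HN : (H <= N)%VS by rewrite -RH.
by rewrite (line_eq dN XH XN HN).
Qed.

(** * The vertex of the cylinder *)

Definition vertices := [set H | (H \notin S) && [forall Q in S, cnt (Q + H) == q]].

Lemma vertexP H : reflect (H \notin S /\ forall Q, Q \in S -> cnt (Q + H) = q) (H \in vertices).
Proof.
rewrite inE; apply: (iffP andP) => [] [HS h]; split=> //.
  by move=> Q QS; apply/eqP/(forall_inP h).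
by apply/forall_inP => Q QS; apply/eqP/h.
Qed.

(** A single q-secant suffices: [vertex_secant] carries it from [P] to a point [X] on 2-secants with
    both [P] and [Q], and from there to [Q]. *)
Lemma vertex_intro P H : P \in S -> H \notin S -> cnt (P + H) = q -> H \in vertices.
Proof.
move=> PS HS cL; apply/vertexP; split=> // Q QS.
have [X [XS XP XQ cPX cQX]] := common_secant PS QS.
have cX := vertex_secant PS HS cL XS XP cPX.
apply: (vertex_secant XS HS cX QS); first by rewrite eq_sym.
by rewrite addvC.
Qed.

Lemma S_inhabited : exists P, P \in S.
Proof.
apply/card_gt0P; rewrite cardS muln_gt0 expn_gt0; by case: q48 => ->.
Qed.

Lemma vertex_line_in P H Y : P \in S -> H \in vertices -> (Y <= P + H)%VS -> Y != H -> Y \in S.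
Proof.
move=> PS /vertexP [HS hH] YL YH; apply: contraNT YH => YS; apply/eqP.
have PH : P != H by apply: contraNneq HS => <-.
exact: hole_unique (dim_join PH) (hH _ PS) YS HS YL (addvSr _ _).
Qed.

(** The line [K] misses [S], since through a point of [S] it would be a q-secant with two holes. It
    remains to show that [X] is the only hole of the line joining it to a point [P] of [S]. *)
Lemma vertices_line H H' X : H \in vertices -> H' \in vertices -> (X <= H + H')%VS -> X \in vertices.
Proof.
move=> HV H'V; have [<-|HH'] := eqVneq H H'; first by rewrite addvv => /subv_points ->.
have [->|XH] := eqVneq X H; first by [].
have [->|XH'] := eqVneq X H'; first by [].
have [HS hH] := vertexP _ HV; have [H'S hH'] := vertexP _ H'V.
have dK := dim_join HH'; set K := (H + H')%VS in dK *; move=> XK.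
have HK : (H <= K)%VS by rewrite addvSl.
have H'K : (H' <= K)%VS by rewrite addvSr.
have XnS : X \notin S.
  apply/negP => XS; have cK : cnt K = q by rewrite -(hH X XS) (line_eq dK).
  by case/eqP: HH'; apply: hole_unique dK cK HS H'S HK H'K.
have [P PS] := S_inhabited.
apply: (vertex_intro PS XnS).
have PX : P != X by apply: contraNneq XnS => <-.
have PH' : P != H' by apply: contraNneq H'S => <-.
have dPX := dim_join PX; have dPH' := dim_join PH'.
have PK : ~~ (P <= K)%VS.
  apply/negP => PK; have cK : cnt K = q by rewrite -(hH' P PS) (line_eq dK).
  by case/eqP: HH'; apply: hole_unique dK cK HS H'S HK H'K.
have KX Y : (Y <= K)%VS -> (Y <= P + X)%VS -> Y = X.
  move=> YK YP; apply/eqP/negP => /negP YX; case/negP: PK.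
  by rewrite -(line_eq dK YX YK XK) (line_eq dPX YX YP (addvSr _ _)) addvSl.
have dA : \dim (K + P) = 3 by rewrite dim_add_point // dK.
(* The line [H Y] meets [P H'] in a point [Q] of [S]; then [Y] is on [Q H], whose points other than
   [H] are all in [S]. *)
have all_in Y : (Y <= P + X)%VS -> Y != X -> Y \in S.
  move=> YL YX; have YnK : ~~ (Y <= K)%VS by apply: contra YX => /KX ->.
  have YH : H != Y by apply: contraNneq YnK => <-.
  have dM := dim_join YH; set M := (H + Y)%VS in dM.
  have HM : (H <= M)%VS by rewrite addvSl.
  have YM : (Y <= M)%VS by rewrite addvSr.
  have YA : (Y <= K + P)%VS by apply: subv_trans YL _; rewrite subv_add addvSr (subv_trans XK) ?addvSl.
  have MA : (M <= K + P)%VS by rewrite subv_add (subv_trans HK) ?addvSl.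
  have NA : (P + H' <= K + P)%VS by rewrite subv_add addvSr (subv_trans H'K) ?addvSl.
  have MN : M <> (P + H')%VS.
    move=> e; case/eqP: HH'; apply: hole_unique dPH' (hH' P PS) HS H'S _ (addvSr _ _).
    by rewrite -e.
  have [Q QE _] := meet_lines dA dM dPH' MA NA MN.
  have QM : (Q <= M)%VS by rewrite -QE capvSl.
  have QN : (Q <= P + H')%VS by rewrite -QE capvSr.
  have QH' : Q != H'.
    apply/eqP => e; case/negP: YnK; rewrite /K (line_eq dM) ?HH' //.
    by rewrite -e.
  have QS := vertex_line_in PS H'V QN QH'.
  have QH : Q != H by apply: contraNneq HS => <-.
  apply: (vertex_line_in QS HV); last by rewrite eq_sym.
  by rewrite (line_eq dM).
have := card_line dPX; rewrite /cnt.
rewrite (cardsD1 X) in_points_of addvSr => /esym; rewrite addnC => /addnI ->.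
apply: eq_card => Y; rewrite in_setI in_setD1 in_points_of.
have [YL|] := boolP (Y <= _)%VS; last by rewrite !andbF.
rewrite !andbT; apply/idP/idP => [YS|]; last exact: all_in.
by apply: contraNneq XnS => <-.
Qed.

Lemma vertex_space : exists tau, forall X, (X <= tau)%VS = (X \in vertices).
Proof.
pose good U := forall X, (X <= U)%VS -> X \in vertices.
have goodD U H : good U -> H \in vertices -> good (U + H)%VS.
  move=> gU HV X XU; have [HU|HU] := boolP (H <= U)%VS.
    by apply: gU; move: XU; rewrite (addv_idPl HU).
  have [-> //|XH] := eqVneq X H.
  (* By dimensions the line [H X] meets [U] in a vertex [Y], so [X] is on a line joining two
     vertices. *)
  have [|Y] := @point_exists F n ((H + X) :&: U)%VS.
    have := dimv_sum_cap (H + X)%VS U; rewrite dim_join 1?eq_sym //.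
    have : (H + X + U <= U + H)%VS by rewrite !subv_add addvSr XU addvSl.
    by move/dimvS; rewrite dim_add_point //; clear; lia.
  rewrite subv_cap => /andP [YHX YU]; apply: (vertices_line HV (gU _ YU)).
  have HX : H != X by rewrite eq_sym.
  have HY : H != Y by apply: contraNneq HU => ->.
  by rewrite (line_eq (dim_join HX) HY (addvSl _ _) YHX) addvSr.
have gsum : good (\sum_(H in vertices) H)%VS.
  elim/big_rec: _ => [X|H U HV gU]; last by rewrite addvC; exact: goodD.
  by move/dimvS; rewrite dim_point dimv0.
exists (\sum_(H in vertices) H)%VS => X; apply/idP/idP => [|XV]; first exact: gsum.
exact: (sumv_sup X).
Qed.

Lemma cylinder_structure : exists T tau, [/\ \dim T = 3, \dim tau = m, (T :&: tau = 0)%VS,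
  cnt T = q + 2 & S = (\bigcup_(P in S :&: points_of T) points_of (P + tau)%VS) :\: points_of tau].
Proof.
have [P PS] := S_inhabited; have [X [XS XP _ cPX _]] := common_secant PS PS.
have [|T [PT XT dT cT]] := hyperoval_plane PS XS _ cPX; first by rewrite eq_sym.
have [tau tauE] := vertex_space; exists T, tau.
(* A vertex in [T] would give a q-secant in [T], hence at least 2q > q + 2 points. *)
have Ttau H : (H <= T)%VS -> ~~ (H <= tau)%VS.
  move=> HT; rewrite tauE; apply/negP => /vertexP [HS hH].
  have PH : P != H by apply: contraNneq HS => <-.
  have LT : (P + H <= T)%VS by rewrite subv_add PT.
  have := cnt_plane_line evenS q_even q_gt2 PS (addvSl P H) LT (dim_join PH) dT.
  by rewrite hH // cT leq_add2l leqNgt q_gt2.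
have cap0 : (T :&: tau = 0)%VS.
  apply/eqP; rewrite -dimv_eq0 -leqn0 leqNgt; apply/negP => /point_exists [H].
  by rewrite subv_cap => /andP [/Ttau /negP].
(* For [Y] off [T] the solid [T + Y] contains a q-secant through [P]. Its hole is a vertex off [T],
   so it spans the solid together with [T]. *)
have full : (T + tau)%VS = fullv.
  apply/eqP; rewrite eqEsubv subvf /=; apply: subv_pointsP => Y _.
  have [YT|YT] := boolP (Y <= T)%VS; first by rewrite (subv_trans YT) ?addvSl.
  have WE : (T + Y)%VS \in ext T fullv by rewrite ext_join ?subvf.
  have dW : \dim (T + Y) = 4 by rewrite dim_add_point // dT.
  have cW := hyperoval_solid dT cT PS PT WE.
  have PW : (P <= T + Y)%VS by rewrite (subv_trans PT) ?addvSl.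
  have [|_ [L [dL PL LW cL]]] := solid_four_or_eight evenS q48 dW PS PW; first by rewrite cW.
  have [|H HS HL] := hole_exists (S := S) dL; first by rewrite cL.
  have PH : P != H by apply: contraNneq HS => <-.
  have Htau : (H <= tau)%VS.
    by rewrite tauE (vertex_intro PS HS) // (line_eq dL).
  have HT : ~~ (H <= T)%VS by apply: contraL Htau; exact: Ttau.
  rewrite (subv_trans (addvSr T Y)) // (ext_joinE WE (subv_trans HL LW) HT).
  by rewrite addvS.
have dtau : \dim tau = m.
  by have := dimv_sum_cap T tau; rewrite cap0 full dim_full dimv0 dT; clear; lia.
split=> //; apply/setP => Y; rewrite in_setD in_points_of.
apply/idP/andP => [YS|[Ytau /bigcupP [Q]]].
  have Ytau : ~~ (Y <= tau)%VS by rewrite tauE; apply/negP => /vertexP []; rewrite YS.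
  split=> //; have [YT|YT] := boolP (Y <= T)%VS.
    by apply/bigcupP; exists Y; rewrite ?in_setI ?YS ?in_points_of ?addvSl.
  (* Project [Y] from [tau] to a point [Q] of [T]. The line [Y Q] meets [tau] in a vertex, so [Q] is
     in [S] along with [Y]. *)
  have dYtau := dim_add_point Ytau.
  have [|Q] := @point_exists F n (T :&: (tau + Y))%VS.
    have := dimv_sum_cap T (tau + Y)%VS; rewrite dYtau dT.
    by have := dimvS (subvf (T + (tau + Y))%VS); rewrite dim_full dtau; clear; lia.
  rewrite subv_cap => /andP [QT QtY].
  have Qtau := Ttau Q QT; have YQ : Y != Q by apply: contraNneq YT => ->.
  have [|H] := @point_exists F n ((Y + Q) :&: tau)%VS.
    have := dimv_sum_cap (Y + Q)%VS tau; rewrite dim_join //.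
    have : (Y + Q + tau <= tau + Y)%VS by rewrite !subv_add addvSr QtY addvSl.
    by move/dimvS; rewrite dYtau; clear; lia.
  rewrite subv_cap => /andP [HYQ Htau].
  have HV : H \in vertices by rewrite -tauE.
  have YH : Y != H by apply: contraNneq Ytau => ->.
  have QH : Q != H by apply: contraNneq Qtau => ->.
  have dYQ := dim_join YQ.
  have QS : Q \in S.
    apply: (vertex_line_in YS HV) => //.
    by rewrite (line_eq dYQ) ?addvSl ?addvSr.
  apply/bigcupP; exists Q; first by rewrite in_setI QS in_points_of.
  rewrite in_points_of (subv_trans _ (addvS (subvv Q) Htau)) //.
  by rewrite (line_eq dYQ) ?addvSl ?addvSr.
rewrite in_setI !in_points_of => /andP [QS QT] YQ.
have [->//|YQ'] := eqVneq Y Q.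
have Qtau := Ttau Q QT.
have [|H] := @point_exists F n ((Y + Q) :&: tau)%VS.
  have := dimv_sum_cap (Y + Q)%VS tau; rewrite dim_join //.
  have : (Y + Q + tau <= tau + Q)%VS by rewrite !subv_add addvSr addvSl andbT [(tau + Q)%VS]addvC YQ.
  by move/dimvS; rewrite dim_add_point //; clear; lia.
rewrite subv_cap => /andP [HYQ Htau].
have HV : H \in vertices by rewrite -tauE.
have YH : Y != H by apply: contraNneq Ytau => ->.
have QH : Q != H by apply: contraNneq Qtau => ->.
apply: (vertex_line_in QS HV) => //.
by rewrite (line_eq (dim_join YQ')) ?addvSl ?addvSr.
Qed.

End Cylinder.

(** * Functions describing hyperovals *)

Local Open Scope ring_scope.

(** These are the functions of normalised o-polynomials: the points (1, t, f t) together with (0, 1,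
    0) and (0, 0, 1) form a hyperoval through (1, 0, 0) and (1, 1, 1). The last condition compares
    two chord slopes, cross-multiplied. *)
Definition o_function (F : fieldType) (f : F -> F) : Prop :=
  [/\ f 0 = 0, f 1 = 1, injective f &
      forall a b c, a != b -> a != c -> b != c -> (f b - f a) * (c - a) != (f c - f a) * (b - a)].

(** For [x] other than 0 and 1, injectivity excludes the values 0 and 1, and noncollinearity with
    the points at 0 and 1 excludes [x]; only x^2 is left. *)
Lemma o_function_four (F : finFieldType) (f : F -> F) : #|F| = 4%N -> o_function f ->
  forall x, f x = x ^+ 2.
Proof.
move=> F4 [f0 f1 finj fs] x.
have [->|x0] := eqVneq x 0; first by rewrite f0 expr0n.
have [->|x1] := eqVneq x 1; first by rewrite f1 expr1n.
have x3 : x ^+ 3 = 1 by apply: (mulfI x0); rewrite -exprS -F4 expf_card mulr1.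
have x21 : x ^+ 2 != 1 by apply: contraNneq x1 => x2; rewrite -x3 exprS x2 mulr1.
have x2x : x ^+ 2 != x by rewrite expr2 -[X in _ == X]mulr1 (inj_eq (mulfI x0)).
have fx0 : f x != 0 by rewrite -f0 (inj_eq finj).
have fx1 : f x != 1 by rewrite -[X in _ != X]f1 (inj_eq finj).
have fxx : f x != x.
  have := fs 0 1 x; rewrite eq_sym oner_eq0 eq_sym x0 eq_sym x1 f0 f1 !subr0 mul1r mulr1.
  by rewrite eq_sym; apply.
apply/eqP/negP => /negP fx2; have : uniq [:: 0; 1; x; x ^+ 2; f x].
  rewrite /= !inE !negb_or eq_sym oner_eq0 eq_sym x0 eq_sym expf_eq0 /= x0.
  by rewrite eq_sym fx0 eq_sym x1 eq_sym x21 eq_sym fx1 eq_sym x2x eq_sym fxx eq_sym fx2.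
by move/card_uniqP => h; have := max_card (mem [:: 0; 1; x; x ^+ 2; f x]); rewrite h F4.
Qed.

(** * O-functions over the field with eight elements *)

Section Eight.
Variable F : finFieldType.
Hypothesis F8 : #|F| = 8%N.

Lemma expr8 (x : F) : x ^+ 8 = x.
Proof. by rewrite -F8 expf_card. Qed.

Lemma expr7 (x : F) : x != 0 -> x ^+ 7 = 1.
Proof. by move=> x0; apply: (mulfI x0); rewrite -exprS expr8 mulr1. Qed.

Lemma char2_addrr (x : F) : x + x = 0.
Proof. by apply: addrr_pchar2; apply: (@card_finPcharP F 2 3). Qed.

Lemma oppr8 (x : F) : - x = x.
Proof. by apply/eqP; rewrite eq_sym -addr_eq0 char2_addrr. Qed.

Lemma sqrrD8 (x y : F) : (x + y) ^+ 2 = x ^+ 2 + y ^+ 2.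
Proof. by rewrite sqrrD mulr2n char2_addrr addr0. Qed.

Lemma exprD4_8 (x y : F) : (x + y) ^+ 4 = x ^+ 4 + y ^+ 4.
Proof. by rewrite -[4%N]/(2 * 2)%N !exprM !sqrrD8. Qed.

Lemma exists_not01 : exists z : F, (z != 0) && (z != 1).
Proof.
have [z h|h] := pickP [pred z : F | (z != 0) && (z != 1)]; first by exists z.
have : (#|F| <= #|[set (0 : F)%R; 1%R]|)%N.
  rewrite -cardsT; apply/subset_leq_card/subsetP => z _; rewrite !inE.
  by have := h z => /= /negbT; rewrite negb_and !negbK.
by rewrite cards2 F8; case: eqP.
Qed.

(** Substituting z x for x multiplies the sum by z^k, which is not 1 because [z] has the prime order
    7. *)
Lemma power_sum k : (0 < k < 7)%N -> \sum_(x : F) x ^+ k = 0.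
Proof.
move=> k7; have [z /andP [z0 z1]] := exists_not01.
have zk : z ^+ k != 1.
  apply: contraNneq z1 => zk; have z7 := expr7 z0.
  have e j : z ^+ (k * j) = 1 by rewrite exprM zk expr1n.
  have e7 j : z ^+ (1 + 7 * j) = 1 -> z == 1.
    by rewrite exprD exprM z7 expr1n mulr1 expr1 => ->.
  (* Each case uses an inverse j of [k] modulo 7, in the form k j = 1 + 7 i. *)
  move: k7 e; case: k zk => [|[|[|[|[|[|[|]]]]]]] // _ _ e.
  - exact: (e7 0%N (e 1%N)).
  - exact: (e7 1%N (e 4%N)).
  - exact: (e7 2%N (e 5%N)).
  - exact: (e7 1%N (e 2%N)).
  - exact: (e7 2%N (e 3%N)).
  - exact: (e7 5%N (e 6%N)).
have : \sum_(x : F) x ^+ k = z ^+ k * \sum_(x : F) x ^+ k.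
  rewrite {1}(reindex_inj (mulfI z0)) mulr_sumr; apply: eq_bigr => x _; exact: exprMn.
move/eqP; rewrite -subr_eq0 -{1}[\sum_x _]mul1r -mulrBl mulf_eq0 subr_eq0 eq_sym (negbTE zk).
by move/eqP.
Qed.

Lemma power_sum7 : \sum_(x : F) x ^+ 7 = 1.
Proof.
rewrite (bigD1 0) //= expr0n add0r (eq_bigr (fun=> 1)) => [|x x0]; last exact: expr7.
rewrite sumr_const; have := cardC1 (0 : F); rewrite F8 => ->.
by rewrite -[7%N]/(3 + 3 + 1)%N !mulrnDr char2_addrr add0r.
Qed.

Section OFunction.
Variable f : F -> F.
Hypothesis fo : o_function f.
Let f0 : f 0 = 0. Proof. by case: fo. Qed.
Let f1 : f 1 = 1. Proof. by case: fo. Qed.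
Let finj : injective f. Proof. by case: fo. Qed.

(** As x^6 is the inverse of a nonzero [x], this is the slope of the chord from [s] to s + x; at x =
    0 the value is 0. *)
Definition slope (s x : F) := (f (s + x) - f s) * x ^+ 6.

(** Slopes at nonzero arguments are nonzero because [f] is injective, and distinct because no three
    points of the graph are collinear. *)
Lemma slope_inj s : injective (slope s).
Proof.
have inv (x : F) : x != 0 -> x ^+ 6 = x^-1.
  by move=> x0; apply: (mulfI x0); rewrite mulfV // -exprS expr7.
have nz x : x != 0 -> slope s x != 0.
  move=> x0; rewrite mulf_neq0 ?expf_neq0 // subr_eq0 (inj_eq finj).
  by rewrite -subr_eq0 addrC addKr.
have z : slope s 0 = 0 by rewrite /slope expr0n mulr0.
move=> x y; have [->|x0] := eqVneq x 0.
  by rewrite z; have [-> //|/nz y0 /esym /eqP] := eqVneq y 0; rewrite (negbTE y0).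
have [->|y0] := eqVneq y 0; first by rewrite z => /eqP; rewrite (negbTE (nz _ x0)).
move=> e; apply/eqP/negP => /negP xy; have [_ _ _ fs] := fo.
have s_neq t : t != 0 -> s != s + t.
  by move=> t0; rewrite eq_sym -subr_eq0 addrC addKr.
have := fs s (s + x) (s + y) (s_neq _ x0) (s_neq _ y0).
rewrite (inj_eq (addrI s)) => /(_ xy) /eqP; apply.
move: e; rewrite /slope !inv // => e.
have e1 t : s + t - s = t by rewrite addrC addKr.
rewrite !e1; apply: (mulIf (invr_neq0 x0)); rewrite -[RHS]mulrA mulfV // mulr1.
by rewrite mulrAC e mulfVK.
Qed.

Lemma sum_slope s k : \sum_x (slope s x) ^+ k = \sum_x x ^+ k.
Proof. by rewrite [RHS](reindex_inj (@slope_inj s)). Qed.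

(** By interpolation this becomes the coefficient of x^(7 - k) in [f] for k < 7. *)
Definition moment k := \sum_y f y * y ^+ k.

Lemma moment0 : moment 0 = 0.
Proof.
transitivity (\sum_(y : F) y ^+ 1); last exact: power_sum.
by rewrite [RHS](reindex_inj finj); apply: eq_bigr => y _; rewrite mulr1 expr1.
Qed.

(* The slopes at s run over all field elements, so they add up to 0 for every s. *)
Lemma moment_poly s : moment 6 + s ^+ 2 * moment 4 + s ^+ 4 * moment 2 + s ^+ 6 * moment 0 = 0.
Proof.
have := sum_slope s 1; rewrite power_sum // => e; rewrite -[RHS]e.
rewrite [RHS](eq_bigr (fun x => f (s + x) * x ^+ 6 - f s * x ^+ 6)); last first.
  by move=> x _; rewrite expr1 /slope mulrBl.
rewrite sumrB -mulr_sumr power_sum // mulr0 subr0.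
rewrite [RHS](reindex_inj (addrI s)) /moment !mulr_sumr -!big_split /=.
apply: eq_bigr => y _; rewrite addrA char2_addrr add0r.
have -> : (s + y) ^+ 6 = (s ^+ 2 + y ^+ 2) * (s ^+ 4 + y ^+ 4).
  by rewrite -sqrrD8 -exprD4_8 -exprD.
ring.
Qed.

(** The identity [moment_poly] is evaluated at 0, at 1 and at an element other than 0 and 1. *)
Lemma moment_even : [/\ moment 2 = 0, moment 4 = 0 & moment 6 = 0].
Proof.
have h s := moment_poly s; have m0 := moment0.
have m6 : moment 6 = 0 by have := h 0; rewrite !expr0n /= !mul0r !addr0.
have e s : s ^+ 2 * moment 4 + s ^+ 4 * moment 2 = 0.
  by have := h s; rewrite m6 m0 mulr0 addr0 add0r.
have e42 : moment 2 = moment 4.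
  by have := e 1; rewrite !expr1n !mul1r => /eqP; rewrite addr_eq0 oppr8 => /eqP.
have [z /andP [z0 z1]] := exists_not01.
have m4 : moment 4 = 0.
  have : z ^+ 2 * (1 + z) ^+ 2 * moment 4 = 0 by rewrite sqrrD8 -[RHS](e z) e42; ring.
  move/eqP; rewrite -exprMn mulf_eq0 sqrf_eq0 mulf_eq0 (negbTE z0) => /orP [|/eqP //].
  by rewrite addr_eq0 oppr8 eq_sym (negbTE z1).
by rewrite e42.
Qed.

Lemma o_poly : forall x, f x = moment 5 * x ^+ 2 + moment 3 * x ^+ 4 + moment 1 * x ^+ 6.
Proof.
have [m2 m4 m6] := moment_even; have m0 := moment0.
(* The factor is 1 for y = x and 0 otherwise, as nonzero elements have seventh power 1. *)
have interp x : f x = \sum_y f y * (1 + (x + y) ^+ 7).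
  rewrite (bigD1 x) //= char2_addrr expr0n addr0 mulr1 big1 ?addr0 // => y yx.
  rewrite expr7 ?char2_addrr ?mulr0 //.
  by rewrite addr_eq0 oppr8 eq_sym.
have gen x : f x = moment 7 + x ^+ 2 * moment 5 + x ^+ 4 * moment 3 + x ^+ 6 * moment 1.
  rewrite interp.
  transitivity (moment 0 + (moment 7 + x * moment 6 + x ^+ 2 * moment 5 + x ^+ 3 * moment 4
    + x ^+ 4 * moment 3 + x ^+ 5 * moment 2 + x ^+ 6 * moment 1 + x ^+ 7 * moment 0)).
    rewrite /moment !mulr_sumr -!big_split /=; apply: eq_bigr => y _.
    have -> : (x + y) ^+ 7 = (x + y) * (x ^+ 2 + y ^+ 2) * (x ^+ 4 + y ^+ 4).
      by rewrite -sqrrD8 -exprD4_8 -exprS -exprD.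
    ring.
  by rewrite m0 m2 m4 m6 !mulr0 !addr0 add0r.
have m7 : moment 7 = 0 by have := gen 0; rewrite f0 !expr0n /= !mul0r !addr0.
by move=> x; rewrite gen m7; ring.
Qed.

Lemma o_function_eight :
  [\/ forall x, f x = x ^+ 2, forall x, f x = x ^+ 4, forall x, f x = x ^+ 6 |
      exists a r, [/\ a != 0, r != 0 & forall x, f x = a * (x ^+ 2 + r * x ^+ 4 + r ^+ 2 * x ^+ 6)]].
Proof.
have := o_poly; set a := moment 5; set b := moment 3; set c := moment 1 => fE.
have abc : a + b + c = 1 by rewrite -f1 fE !expr1n !mulr1.
pose g x := a * x + b * x ^+ 3 + c * x ^+ 5.
have gE x : g x = slope 0 x.
  rewrite /slope add0r f0 subr0 fE /g.
  have x8 := expr8 x; rewrite -{1}x8 -[x ^+ 3](_ : x ^+ 8 * x ^+ 2 = _); last by rewrite x8 -exprS.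
  rewrite -[x ^+ 5](_ : x ^+ 8 * x ^+ 4 = _); last by rewrite x8 -exprS.
  ring.
have ginj : injective g by move=> x y; rewrite !gE; exact: slope_inj.
(* After reduction by x^8 = x, only the term in x^7 of the cubed slope survives the summation. *)
have key : a * (a * c + b ^+ 2) = 0.
  have := sum_slope 0 3; rewrite power_sum // => e; rewrite -[RHS]e.
  transitivity (\sum_x (a ^+ 3 * x ^+ 3 + a ^+ 2 * b * x ^+ 5 + (a * b ^+ 2 + a ^+ 2 * c) * x ^+ 7
    + b ^+ 3 * x ^+ 2 + (a * c ^+ 2 + b ^+ 2 * c) * x ^+ 4 + b * c ^+ 2 * x ^+ 6 + c ^+ 3 * x ^+ 1)).
    rewrite !big_split /= -!mulr_sumr power_sum7 !power_sum //; ring.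
  apply: eq_bigr => x _; rewrite -gE /g [RHS]exprS !sqrrD8.
  have red k : x ^+ (8 + k) = x ^+ k.+1 by rewrite exprD expr8 exprS.
  have x15 : x ^+ 15 = x ^+ 1 by rewrite -[15%N]/(8 + 7)%N red expr8.
  rewrite -x15 -(red 1%N) -(red 3%N) -(red 5%N); ring.
have [a0|a0] := eqVneq a 0.
  have [b0|b0] := eqVneq b 0.
    constructor 3 => x; rewrite fE a0 b0; move: abc; rewrite a0 b0 !add0r => ->.
    by rewrite !mul0r !add0r mul1r.
  have [c0|c0] := eqVneq c 0.
    constructor 2 => x; rewrite fE a0 c0; move: abc; rewrite a0 c0 add0r addr0 => ->.
    by rewrite !mul0r add0r addr0 mul1r.
  (* A fourth power is a square root here, since y^8 = y. This [x] would be a second zero of the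
     injective [g]. *)
  pose x := (b / c) ^+ 4; have x2 : x ^+ 2 = b / c by rewrite -exprM expr8.
  have x0 : x != 0 by rewrite expf_neq0 // mulf_neq0 ?invr_eq0.
  case/eqP: x0; apply: ginj.
  rewrite /g a0 !expr0n /= !mulr0 mul0r !addr0 add0r -[5%N]/(2 + 3)%N exprD x2.
  by rewrite mulrA [c * _]mulrC mulfVK // char2_addrr.
move/eqP: key; rewrite mulf_eq0 (negbTE a0) /= addr_eq0 oppr8 => /eqP key.
have [b0|b0] := eqVneq b 0.
  have c0 : c = 0 by apply: (mulfI a0); rewrite key b0 expr0n mulr0.
  constructor 1 => x; rewrite fE b0 c0; move: abc; rewrite b0 c0 !addr0 => ->.
  by rewrite !mul0r !addr0 mul1r.
(* With r = b / a, the relation a c = b^2 gives c = a r^2. *)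
constructor 4; exists a, (b / a); split=> //; first by rewrite mulf_neq0 ?invr_eq0.
move=> x; rewrite fE; have -> : c = b ^+ 2 / a by rewrite -key mulrC mulKf.
by field.
Qed.

End OFunction.
End Eight.

(** * Regular hyperovals *)

Section Frames.
Variables (F : finFieldType) (n : nat).
Local Notation V := 'rV[F]_n.+1.
Local Notation pt := (point F n).
Implicit Types (T : {vspace V}) (O : {set pt}) (u v w : V).

Lemma vline_scale (k : F) v : k != 0 -> (<[k *: v]> = <[v]>)%VS.
Proof.
move=> k0; apply/eqP; rewrite eqEsubv -!memvE memvZ ?memv_line //=.
by apply/vlineP; exists k^-1; rewrite scalerA mulVf // scale1r.
Qed.

Definition free3 u v w := forall x y z : F,
  x *: u + y *: v + z *: w = 0 -> [/\ x = 0, y = 0 & z = 0].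

Lemma free3_coord u v w x y z x' y' z' : free3 u v w ->
  x *: u + y *: v + z *: w = x' *: u + y' *: v + z' *: w -> [/\ x = x', y = y' & z = z'].
Proof.
move=> fr e; have [|] := fr (x - x') (y - y') (z - z').
  apply/rowP => i; have /rowP /(_ i) := e; rewrite !mxE => ei.
  transitivity (x * u 0 i + y * v 0 i + z * w 0 i - (x' * u 0 i + y' * v 0 i + z' * w 0 i)).
    ring.
  by rewrite ei subrr.
by move=> /subr0_eq -> /subr0_eq -> /subr0_eq ->.
Qed.

Lemma vline3P u v w p : p \in (<[u]> + <[v]> + <[w]>)%VS -> exists x y z, p = x *: u + y *: v + z *: w.
Proof.
case/memv_addP => p1 /memv_addP [p2 /vlineP [x ->] [p3 /vlineP [y ->] ->]] [p4 /vlineP [z ->] ->].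
by exists x, y, z.
Qed.

Definition framed T O u v w (f : F -> F) := [/\ free3 u v w, T = (<[u]> + <[v]> + <[w]>)%VS &
  forall P : pt, P \in O <->
    [\/ exists t, point_space P = <[u + t *: v + f t *: w]>%VS, point_space P = <[v]>%VS |
        point_space P = <[w]>%VS]].

(** The linear map taking the standard basis to [u], [v], [w] sends the conic points with nonzero s
    to the graph, the one with s = 0 to [w] and the nucleus to [v]. *)
Lemma framed_square T O u v w : framed T O u v w (fun t => t ^+ 2) ->
  exists f : 'Hom('rV[F]_3, V),
    [/\ lker f = 0%VS, limg f = T & O = map_points f (conic_nucleus F)].
Proof.
move=> [fr TE OE]; pose M : 'M[F]_(3, n.+1) := \matrix_(i < 3) [:: u; v; w]`_i.
pose f : 'Hom('rV[F]_3, V) := linfun (mulmxr M); exists f.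
have fE (r : 'rV[F]_3) : f r = r 0 0 *: u + r 0 1 *: v + r 0 2%:R *: w.
  rewrite lfunE /= mulmx_sum_row !big_ord_recl big_ord0 addr0 !rowK /= addrA.
  by congr (_ + _ *: _ + _ *: _); congr (r 0 _); apply: val_inj.
have f3 x y z : f (row3 x y z) = x *: u + y *: v + z *: w.
  by rewrite fE !mxE.
have fl (r : 'rV[F]_3) : (f @: <[r]> = <[f r]>)%VS by rewrite limg_line.
have k0 : lker f = 0%VS.
  apply/eqP; rewrite -subv0; apply/subvP => r; rewrite memv_ker fE => /eqP /fr [r0 r1 r2].
  rewrite memv0; apply/eqP/rowP => i; rewrite mxE.
  case: i => [[|[|[|//]]] h]; [rewrite -r0|rewrite -r1|rewrite -r2]; congr (r 0 _); exact: val_inj.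
split=> //.
  apply/eqP; rewrite eqEsubv; apply/andP; split; apply/subvP => p.
    case/memv_imgP => r _ ->; rewrite fE TE.
    by rewrite !memv_add ?memvZ ?memv_line.
  rewrite TE => /vline3P [x [y [z ->]]]; rewrite -f3.
  by apply: memv_img; rewrite memvf.
have vpoint (r : 'rV[F]_3) : r != 0 -> exists P : point F 2, point_space P = <[r]>%VS.
  by move=> r0; exists (vpt r0).
have row30 (x y z : F) : row3 x y z = 0 -> [/\ x = 0, y = 0 & z = 0].
  move=> e; split; [have := congr1 (fun r : 'rV[F]_3 => r 0 0) e|have := congr1 (fun r : 'rV[F]_3 => r 0 1) e|
     have := congr1 (fun r : 'rV[F]_3 => r 0 2%:R) e]; by rewrite !mxE.
apply/setP => Q; apply/idP/idP => [/OE QO|].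
  have h (r : 'rV[F]_3) : r != 0 -> point_space Q = <[f r]>%VS ->
      (forall P : point F 2, point_space P = <[r]>%VS -> P \in conic_nucleus F) ->
      Q \in map_points f (conic_nucleus F).
    move=> r0 Qr hr; have [P PE] := vpoint r r0; rewrite inE; apply/existsP; exists P.
    by rewrite hr // PE fl Qr eqxx.
  case: QO => [[t Qt]|Qv|Qw].
  - apply: (h (row3 (1 ^+ 2) (1 * t) (t ^+ 2))).
    + by apply/eqP => /row30 [/eqP]; rewrite expr1n oner_eq0.
    + by rewrite Qt f3 expr1n scale1r mul1r.
    + move=> P PE; rewrite inE; apply/orP; left; apply/existsP; exists 1; apply/existsP; exists t.
      by rewrite PE eqxx andbT xpair_eqE oner_eq0.
  - apply: (h (row3 0 1 0)).
    + by apply/eqP => /row30 [_ /eqP]; rewrite oner_eq0.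
    + by rewrite Qv f3 !scale0r scale1r add0r addr0.
    + by move=> P PE; rewrite inE PE eqxx orbT.
  - apply: (h (row3 (0 ^+ 2) (0 * 1) (1 ^+ 2))).
    + by apply/eqP => /row30 [_ _ /eqP]; rewrite expr1n oner_eq0.
    + by rewrite Qw f3 expr0n mul0r expr1n !scale0r scale1r !add0r.
    + move=> P PE; rewrite inE; apply/orP; left; apply/existsP; exists 0; apply/existsP; exists 1.
      by rewrite PE eqxx andbT xpair_eqE oner_eq0 andbF.
rewrite inE => /existsP [P /andP [PC /eqP QP]]; apply/OE; rewrite QP.
move: PC; rewrite inE => /orP [|/eqP ->]; last first.
  by constructor 2; rewrite fl f3 !scale0r scale1r add0r addr0.
case/existsP => s /existsP [t /andP [st /eqP ->]]; rewrite fl f3.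
have [s0|s0] := eqVneq s 0.
  constructor 3; move: st; rewrite s0 xpair_eqE eqxx /= => t0.
  by rewrite expr0n mul0r !scale0r !add0r vline_scale // expf_neq0.
(* Dividing (s^2, s t, t^2) by s^2 normalises the first coordinate to 1. *)
constructor 1; exists (t / s).
rewrite -[in RHS](@vline_scale (s ^+ 2)) ?expf_neq0 // !scalerDr !scalerA.
have -> : s ^+ 2 * (t / s) = s * t by field.
by have -> : s ^+ 2 * (t / s) ^+ 2 = t ^+ 2 by field.
Qed.

(** As t^8 = t, the point (1, t, t^4) is (1, s^2, s) for s = t^4. *)
Lemma framed_fourth T O u v w : #|F| = 8%N ->
  framed T O u v w (fun t => t ^+ 4) -> framed T O u w v (fun t => t ^+ 2).
Proof.
move=> F8 [fr TE OE]; split.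
- move=> x y z; rewrite addrAC => /fr [-> -> ->] //.
- by rewrite TE -addvA [(<[v]> + _)%VS]addvC addvA.
move=> P; split=> [/OE [[t ->]|->|->]|PE].
- by constructor 1; exists (t ^+ 4); rewrite -exprM expr8 // addrAC.
- by constructor 3.
- by constructor 2.
apply/OE; case: PE => [[t ->]|->|->].
- by constructor 1; exists (t ^+ 2); rewrite -exprM expr8 // addrAC.
- by constructor 3.
- by constructor 2.
Qed.

(** Dividing (1, t, t^6) by t gives (s, 1, s^2) with s = 1/t, because t^7 = 1. The points [u] and
    [v] exchange the parameters 0 and infinity. *)
Lemma framed_sixth T O u v w : #|F| = 8%N ->
  framed T O u v w (fun t => t ^+ 6) -> framed T O v u w (fun t => t ^+ 2).
Proof.
move=> F8 [fr TE OE]; split.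
- by move=> x y z; rewrite [x *: _ + _]addrC => /fr [-> -> ->].
- by rewrite TE [(<[u]> + _)%VS]addvC.
have scale (t : F) : t != 0 -> <[u + t *: v + t ^+ 6 *: w]>%VS = <[v + t^-1 *: u + t^-1 ^+ 2 *: w]>%VS.
  move=> t0; rewrite -[in RHS](@vline_scale t) // !scalerDr !scalerA mulfV // scale1r [in RHS](addrC (t *: v)).
  congr (<[_ + _ *: _]>%VS); apply: (mulIf t0); rewrite -exprSr expr7 //; by field.
move=> P; split=> [/OE [[t ->]|->|->]|PE].
- have [->|t0] := eqVneq t 0; last by constructor 1; exists t^-1; exact: scale.
  by constructor 2; rewrite expr0n !scale0r !addr0.
- by constructor 1; exists 0; rewrite expr0n !scale0r !addr0.
- by constructor 3.
apply/OE; case: PE => [[t ->]|->|->].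
- have [->|t0] := eqVneq t 0; first by constructor 2; rewrite expr0n !scale0r !addr0.
  by constructor 1; exists t^-1; rewrite scale ?invr_eq0 // invrK.
- by constructor 1; exists 0; rewrite expr0n !scale0r !addr0.
- by constructor 3.
Qed.

(* With rho^2 = r and x = rho t + 1, the value a (t^2 + r t^4 + r^2 t^6) is (a / r) (x^6 + 1). *)
Lemma framed_cubic T O u v w (a r : F) : #|F| = 8%N -> a != 0 -> r != 0 ->
  framed T O u v w (fun t => a * (t ^+ 2 + r * t ^+ 4 + r ^+ 2 * t ^+ 6)) ->
  exists u' v' w', framed T O u' v' w' (fun t => t ^+ 6).
Proof.
move=> F8 a0 r0 [fr TE OE].
have [rho rho2] : exists rho, rho ^+ 2 = r by exists (r ^+ 4); rewrite -exprM expr8.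
have rho4 : rho ^+ 4 = r ^+ 2 by rewrite -rho2 -exprM.
have rho0 : rho != 0 by apply: contraNneq r0 => h; rewrite -rho2 h expr0n.
set k := rho^-1; set l := a / r.
have k0 : k != 0 by rewrite invr_eq0.
have l0 : l != 0 by rewrite mulf_neq0 ?invr_eq0.
have change t : u + t *: v + (a * (t ^+ 2 + r * t ^+ 4 + r ^+ 2 * t ^+ 6)) *: w =
    (u + k *: v + l *: w) + (rho * t + 1) *: (k *: v) + (rho * t + 1) ^+ 6 *: (l *: w).
  apply/rowP => i; rewrite !mxE.
  have two : 2%:R = 0 :> F by rewrite mulr2n char2_addrr.
  have e6 : (rho * t + 1) ^+ 6 = (r * t ^+ 2) ^+ 3 + (r * t ^+ 2) ^+ 2 + r * t ^+ 2 + 1.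
    rewrite -[6%N]/(2 + 4)%N exprD sqrrD8 // exprD4_8 // !expr1n !exprMn.
    by rewrite rho2 rho4; ring.
  rewrite e6 /l.
  have -> : (rho * t + 1) * (k * v 0 i) = t * v 0 i + k * v 0 i by rewrite /k; field.
  have -> : forall x y z x' y' : F, x + y + z + (x' + y) + y' = x + x' + (z + y') + (y + y).
    by move=> *; ring.
  rewrite char2_addrr // addr0; congr (_ + _).
  transitivity (a * (t ^+ 2 + r * t ^+ 4 + r ^+ 2 * t ^+ 6) * w 0 i + 2%:R * (a / r * w 0 i)).
    by rewrite two mul0r addr0.
  by field.
exists (u + k *: v + l *: w), (k *: v), (l *: w); split.
- move=> x y z e.
  have [|x0 y0 z0] := fr x (x * k + y * k) (x * l + z * l).
    by rewrite -[RHS]e; apply/rowP => i; rewrite !mxE; ring.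
  move: y0 z0; rewrite x0 !mul0r !add0r => /eqP; rewrite mulf_eq0 (negbTE k0) orbF => /eqP -> /eqP.
  by rewrite mulf_eq0 (negbTE l0) orbF => /eqP ->.
- rewrite TE !(vline_scale _ k0) !(vline_scale _ l0); apply/eqP; rewrite eqEsubv !subv_add.
  have uE : u = (u + k *: v + l *: w) + (- k) *: v + (- l) *: w by apply/rowP => i; rewrite !mxE; ring.
  rewrite -!memvE; apply/andP; split; apply/andP; split; try (apply/andP; split).
  + by rewrite {1}uE !memv_add ?memvZ ?memv_line.
  + by rewrite (subvP (subv_trans (addvSr _ _) (addvSl _ _))) ?memv_line.
  + by rewrite (subvP (addvSr _ _)) ?memv_line.
  + by rewrite !memv_add ?memvZ ?memv_line.
  + by rewrite (subvP (subv_trans (addvSr _ _) (addvSl _ _))) ?memv_line.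
  + by rewrite (subvP (addvSr _ _)) ?memv_line.
move=> P; split=> [/OE [[t ->]|->|->]|PE].
- by constructor 1; exists (rho * t + 1); rewrite -change.
- by constructor 2; rewrite vline_scale.
- by constructor 3; rewrite vline_scale.
apply/OE; case: PE => [[t ->]|->|->].
- constructor 1; exists (k * (t - 1)); rewrite change.
  have -> : rho * (k * (t - 1)) + 1 = t by rewrite /k; field.
  by [].
- by constructor 2; rewrite vline_scale.
- by constructor 3; rewrite vline_scale.
Qed.

(** * Coordinates for a hyperoval *)

Section Hyperoval.
Variables (T : {vspace V}) (O : {set pt}).
Hypothesis hypO : is_hyperoval T O.
Hypothesis q_gt2 : (2 < #|F|)%N.

Lemma hyperoval_noncollinear P Q R : P \in O -> Q \in O -> R \in O -> P != Q -> P != R -> Q != R ->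
  ~~ (R <= P + Q)%VS.
Proof.
move=> PO QO RO PQ PR QR; have [_ OT _ lines] := hypO; apply/negP => RL.
have inT X : X \in O -> (X <= T)%VS by move=> XO; have := subsetP OT X XO; rewrite in_points_of.
have dL := pdim_line (dim_join PQ).
have LT : (P + Q <= T)%VS by rewrite subv_add !inT.
have : (#|P |: [set Q; R]| <= #|O :&: points_of (P + Q)%VS|)%N.
  apply/subset_leq_card/subsetP => X; rewrite !inE => /or3P [] /eqP ->; rewrite ?PO ?QO ?RO //=.
  - exact: addvSl.
  - exact: addvSr.
rewrite (cards3 PQ PR QR).
by have [->|->] := lines _ dL LT.
Qed.

(** Four points [A], [B], [C], [D] of [O] serve as projective frame, with basis vectors scaled so
    that [D] is u + v + w. Then [A] and [D] give f 0 = 0 and f 1 = 1, while [B] and [C] are the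
    points at infinity. *)
Lemma hyperoval_frame : exists u v w, exists f, o_function f /\ framed T O u v w f.
Proof.
have [/pdimE dT OT cO _] := hypO.
have inT X : X \in O -> (X <= T)%VS by move=> XO; have := subsetP OT X XO; rewrite in_points_of.
have pickO (E : {set pt}) : (#|E| < #|F| + 2)%N -> exists2 X, X \in O & X \notin E.
  rewrite -cO => h; apply/subsetPn; apply: contraL h => /subset_leq_card; by rewrite leqNgt.
have [A AO _] := pickO set0 ltac:(by rewrite cards0 addn2).
have [B BO] := pickO [set A] ltac:(by rewrite cards1; lia); rewrite inE => BA.
have [C CO] := pickO [set A; B] ltac:(by rewrite cards2 eq_sym BA; lia).
rewrite !inE negb_or => /andP [CA CB].
have AB : A != B by rewrite eq_sym.
have [D DO] := pickO (C |: [set A; B]) ltac:(by rewrite (cards3 CA CB AB); move: q_gt2; clear; lia).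
rewrite !inE !negb_or => /and3P [DC DA DB].
have neq (X Y : pt) : X != Y -> Y != X by rewrite eq_sym.
have nAC := neq _ _ CA; have nBC := neq _ _ CB; have nCD := neq _ _ DC.
have nAD := neq _ _ DA; have nBD := neq _ _ DB.
have nABC := hyperoval_noncollinear AO BO CO AB nAC nBC.
have TE : (A + B + C)%VS = T.
  apply: eq_dim; first by rewrite !subv_add !inT.
  by rewrite (dim_add_point nABC) (dim_join AB) dT.
have [a a0 AE] := point_exists_vec A; have [b b0 BE] := point_exists_vec B.
have [c c0 CE] := point_exists_vec C; have [d d0 DE] := point_exists_vec D.
have [x [y [z dE]]] : exists x y z, d = x *: a + y *: b + z *: c.
  by apply: vline3P; rewrite -AE -BE -CE TE memvE -DE inT.
have two (X Y Z : pt) (e g h : V) (i j : F) : X \in O -> Y \in O -> Z \in O ->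
    X != Y -> X != Z -> Y != Z -> point_space X = <[e]>%VS -> point_space Y = <[g]>%VS ->
    point_space Z = <[h]>%VS -> h = i *: e + j *: g -> False.
  move=> XO YO ZO XY XZ YZ XE YE ZE hE; have /negP := hyperoval_noncollinear XO YO ZO XY XZ YZ.
  by rewrite ZE XE YE -memvE hE memv_add ?memvZ ?memv_line.
have x0 : x != 0.
  apply/eqP => x0; apply: (two B C D b c d y z BO CO DO nBC nBD nCD BE CE DE).
  by rewrite dE x0 scale0r add0r.
have y0 : y != 0.
  apply/eqP => y0; apply: (two A C D a c d x z AO CO DO nAC nAD nCD AE CE DE).
  by rewrite dE y0 scale0r addr0.
have z0 : z != 0.
  apply/eqP => z0; apply: (two A B D a b d x y AO BO DO AB nAD nBD AE BE DE).
  by rewrite dE z0 scale0r addr0.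
have [u uE] : exists u, u = x *: a by exists (x *: a).
have [v vE] : exists v, v = y *: b by exists (y *: b).
have [w wE] : exists w, w = z *: c by exists (z *: c).
have {}AE : point_space A = <[u]>%VS by rewrite uE vline_scale.
have {}BE : point_space B = <[v]>%VS by rewrite vE vline_scale.
have {}CE : point_space C = <[w]>%VS by rewrite wE vline_scale.
have {}DE : point_space D = <[u + v + w]>%VS by rewrite DE dE uE vE wE.
have fr : free3 u v w.
  move=> i j k e.
  have i0 : i = 0.
    apply/eqP/negP => /negP i0; apply: (two B C A v w u (- j / i) (- k / i) BO CO AO nBC BA CA BE CE AE).
    apply: (scalerI i0); rewrite scalerDr !scalerA ![i * _]mulrC !mulfVK // !scaleNr.
    by apply/eqP; rewrite -subr_eq0 !opprD !opprK addrA e.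
  have j0 : j = 0.
    apply/eqP/negP => /negP j0; apply: (two A C B u w v (- i / j) (- k / j) AO CO BO nAC AB CB AE CE BE).
    apply: (scalerI j0); rewrite scalerDr !scalerA ![j * _]mulrC !mulfVK // !scaleNr.
    by apply/eqP; rewrite -subr_eq0 !opprD !opprK addrA [j *: v + _]addrC e.
  split=> //; move: e; rewrite i0 j0 !scale0r !add0r => /eqP; rewrite scaler_eq0 => /orP [/eqP //|].
  by rewrite wE scaler_eq0 (negbTE z0) (negbTE c0).
have {}TE : T = (<[u]> + <[v]> + <[w]>)%VS by rewrite -AE -BE -CE TE.
have [p pE] : exists p : F -> F -> V, forall t s, p t s = u + t *: v + s *: w.
  by exists (fun t s => u + t *: v + s *: w).
pose inO (e : V) := [exists P in O, point_space P == <[e]>%VS].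
have inOP e : reflect (exists2 P, P \in O & point_space P = <[e]>%VS) (inO e).
  by apply: (iffP existsP) => [[P /andP [PO /eqP PE]]|[P PO PE]]; exists P; rewrite ?PO ?PE ?eqxx.
have Av : inO u by apply/inOP; exists A.
have Bv : inO v by apply/inOP; exists B.
have Cv : inO w by apply/inOP; exists C.
have p_inj t s t' s' : <[p t s]>%VS = <[p t' s']>%VS -> t = t' /\ s = s'.
  move=> e; have : p t s \in <[p t' s']>%VS by rewrite -e memv_line.
  case/vlineP => k; rewrite !pE !scalerDr !scalerA -{1}[u]scale1r.
  by case/(free3_coord fr) => <-; rewrite !mul1r.
have p_v t s : <[p t s]>%VS <> <[v]>%VS.
  move=> e; have : p t s \in <[v]>%VS by rewrite -e memv_line.
  case/vlineP => k ke; have [|/eqP] := @free3_coord u v w 1 t s 0 k 0 fr; last by rewrite oner_eq0.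
  by rewrite !scale0r scale1r add0r addr0 -ke pE.
have p_w t s : <[p t s]>%VS <> <[w]>%VS.
  move=> e; have : p t s \in <[w]>%VS by rewrite -e memv_line.
  case/vlineP => k ke; have [|/eqP] := @free3_coord u v w 1 t s 0 0 k fr; last by rewrite oner_eq0.
  by rewrite !scale0r scale1r !add0r -ke pE.
have noncol e g h i j : inO e -> inO g -> inO h -> <[e]>%VS <> <[g]>%VS -> <[e]>%VS <> <[h]>%VS ->
    <[g]>%VS <> <[h]>%VS -> h = i *: e + j *: g -> False.
  move=> /inOP [X XO XE] /inOP [Y YO YE] /inOP [Z ZO ZE] eg eh gh; apply: (two X Y Z) => //.
  - by apply/eqP => XY; apply: eg; rewrite -XE -YE XY.
  - by apply/eqP => XZ; apply: eh; rewrite -XE -ZE XZ.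
  - by apply/eqP => YZ; apply: gh; rewrite -YE -ZE YZ.
(* Two points with the same first parameter would be collinear with [C]. *)
have uniq_s t s s' : inO (p t s) -> inO (p t s') -> s = s'.
  move=> h h'; apply/eqP/negP => /negP ss'.
  apply: (noncol _ w _ 1 (s' - s) h Cv h' (p_w _ _)).
  - by move=> e; case: (p_inj _ _ _ _ e) => _ /eqP; rewrite (negbTE ss').
  - by move/esym; exact: p_w.
  - by rewrite !pE scale1r scalerBl addrA [_ + s *: w + _]addrAC addrK.
have cases P : P \in O -> [\/ exists t s, point_space P = <[p t s]>%VS, P = B | P = C].
  move=> PO; have [e e0 PE] := point_exists_vec P.
  have [i [j [k eE]]] : exists i j k, e = i *: u + j *: v + k *: w.
    by apply: vline3P; rewrite -TE memvE -PE inT.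
  have [i0|i0] := eqVneq i 0.
    have [->|PB] := eqVneq P B; first by constructor 2.
    have [->|PC] := eqVneq P C; first by constructor 3.
    case: (two B C P v w e j k BO CO PO nBC (neq _ _ PB) (neq _ _ PC) BE CE PE).
    by rewrite eE i0 scale0r add0r.
  constructor 1; exists (j / i), (k / i); rewrite PE -[RHS](vline_scale _ i0); congr (<[_]>%VS).
  by rewrite eE pE !scalerDr !scalerA ![i * _]mulrC !mulfVK.
(* The default 0 is provisional: [inf] below shows that every [t] has a point of [O]. *)
have [f fP] : exists f : F -> F, forall t s, inO (p t s) -> f t = s.
  exists (fun t => odflt 0 [pick s | inO (p t s)]) => t s.
  by case: pickP => [s' h /(uniq_s _ _ _ h) //|h]; rewrite h.
pose Dm := [set t | [exists s, inO (p t s)]].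
(* The q + 2 points of [O] lie among one point for each element of [Dm] and the two points at
   infinity. *)
have card_Dm : (#|F| <= #|Dm|)%N.
  have : (#|[set point_space P | P : pt in O]| <= #|[set <[p t (f t)]>%VS | t in Dm] :|: [set <[v]>; <[w]>]%VS|)%N.
    apply/subset_leq_card/subsetP => _ /imsetP [P PO ->]; rewrite inE.
    have [[t [s PE]]|->|->] := cases P PO; last 2 first.
    - by rewrite BE !inE eqxx orbT.
    - by rewrite CE !inE eqxx !orbT.
    have h : inO (p t s) by apply/inOP; exists P.
    apply/orP; left; apply/imsetP; exists t; last by rewrite PE (fP _ _ h).
    by rewrite inE; apply/existsP; exists s.
  rewrite card_imset; last exact: point_inj.
  rewrite cO => h; have := leq_trans h (leq_card_setU _ _).
  have := leq_imset_card (fun t => <[p t (f t)]>%VS) Dm; rewrite cards2; set k := #|imset _ _|.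
  by case: (_ != _); clear; rewrite /=; lia.
have inf t : inO (p t (f t)).
  have : t \in Dm.
    have : Dm == setT by rewrite eqEcard subsetT cardsT card_Dm.
    by move/eqP => ->; rewrite in_setT.
  by rewrite inE => /existsP [s h]; rewrite (fP _ _ h).
exists u, v, w, f; split; last first.
  split=> // P; split=> [PO|[[t PE]|PE|PE]].
  - have [[t [s PE]]|->|->] := cases P PO; last 2 first.
    + by constructor 2.
    + by constructor 3.
    constructor 1; exists t; have h : inO (p t s) by apply/inOP; exists P.
    by rewrite (fP _ _ h) -pE.
  - by have /inOP [Q QO QE] := inf t; rewrite (_ : P = Q) //; apply: point_inj; rewrite PE QE pE.
  - by rewrite (_ : P = B) //; apply: point_inj; rewrite PE BE.
  - by rewrite (_ : P = C) //; apply: point_inj; rewrite PE CE.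
split.
- by apply: fP; rewrite pE !scale0r !addr0.
- by apply: fP; rewrite pE !scale1r; apply/inOP; exists D.
- move=> t t' ft; apply/eqP/negP => /negP tt'.
  apply: (noncol _ v _ 1 (t' - t) (inf t) Bv (inf t') (p_v _ _)).
  + by move=> e; case: (p_inj _ _ _ _ e) => /eqP; rewrite (negbTE tt').
  + by move/esym; exact: p_v.
  + by rewrite !pE ft; apply/rowP => i; rewrite !mxE; ring.
move=> r s t rs rt st; apply/eqP => e.
(* The weights write [t] as an affine combination of [r] and [s]; equal slopes make the same
   combination hold for the values of [f]. *)
apply: (noncol _ _ _ (1 - (t - r) / (s - r)) ((t - r) / (s - r)) (inf r) (inf s) (inf t)).
- by move=> e'; case: (p_inj _ _ _ _ e') => /eqP; rewrite (negbTE rs).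
- by move=> e'; case: (p_inj _ _ _ _ e') => /eqP; rewrite (negbTE rt).
- by move=> e'; case: (p_inj _ _ _ _ e') => /eqP; rewrite (negbTE st).
have sr : s - r != 0 by rewrite subr_eq0 eq_sym.
have ft : f t = f r + (f s - f r) * (t - r) / (s - r) by rewrite e mulfK // addrC subrK.
by rewrite !pE ft; apply/rowP => i; rewrite !mxE; field.
Qed.

End Hyperoval.

Lemma hyperoval_regular T O : #|F| = 4%N \/ #|F| = 8%N -> is_hyperoval T O -> is_regular_hyperoval T O.
Proof.
move=> q48 hO; split=> //.
have q_gt2 : (2 < #|F|)%N by case: q48 => ->.
have [u [v [w [f [fo fr]]]]] := hyperoval_frame hO q_gt2.
have ext g : f =1 g -> framed T O u v w g.
  move=> fg; have [fr3 TE OE] := fr; split=> // P; split=> [/OE [[t]|h|h]|[[t]|h|h]].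
  - by rewrite fg; constructor 1; exists t.
  - by constructor 2.
  - by constructor 3.
  - by rewrite -fg => h; apply/OE; constructor 1; exists t.
  - by apply/OE; constructor 2.
  - by apply/OE; constructor 3.
case: q48 => q48; first exact: framed_square (ext _ (o_function_four q48 fo)).
have [f2|f4|f6|[a [r [a0 r0 fE]]]] := o_function_eight q48 fo.
- exact: framed_square (ext _ f2).
- exact: framed_square (framed_fourth q48 (ext _ f4)).
- exact: framed_square (framed_sixth q48 (ext _ f6)).
have [u' [v' [w' fr']]] := framed_cubic q48 a0 r0 (ext _ fE).
exact: framed_square (framed_sixth q48 fr').
Qed.

End Frames.

(** * The base of the cylinder as a regular hyperoval *)

Theorem theorem1p1 (F : finFieldType) (q n : nat)
    (hF : #|F| = q) (hq : q = 4%N \/ q = 8%N) (hn : (2 <= n)%N)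
    (S : {set point F n})
    (hS : even_type S)
    (hcard : #|S| = (q ^ (n - 2) * (q + 2))%N) :
  exists (pi tau : proj_subspace F n) (O : {set point F n}),
    [/\ skew_subspaces pi tau,
        pdim pi = 2,
        pdim tau = n%:Z - 3,
        is_regular_hyperoval pi O
      & S = (\bigcup_(P in O) points_of (point_space P + tau)%VS)
              :\: points_of tau].
Proof.
(* Put n = m + 2: the vertex has vector space dimension m, hence projective dimension m - 1 = n -
   3. *)
subst q; case: n hn S hS hcard => [|[|m]] // _ S hS; rewrite !subSS subn0 => hcard.
have [T [tau [dT dtau cap cT SE]]] := cylinder_structure hS hq hcard.
exists T, tau, (S :&: points_of T); split=> //.
- apply/eqP/setP => P; rewrite !inE -subv_cap cap; apply/negP => /dimvS.
  by rewrite dim_point dimv0.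
- exact/pdimE.
- by rewrite /pdim dtau; lia.
apply: hyperoval_regular => //; split; [exact/pdimE | exact: subsetIr | exact: cT |].
move=> l /pdimE dl lT.
have -> : S :&: points_of T :&: points_of l = S :&: points_of l.
  rewrite -setIA; congr (_ :&: _); apply/setIidPr/subsetP => P.
  by rewrite !in_points_of => /subv_trans; apply.
have [c0|/cnt_gt0P [P PS Pl]] := posnP (cnt S l); first by left.
(* With q + 2 points in the plane there is no excess at [P], so [l] is a 2-secant. *)
right; apply/eqP; rewrite eqn_leq (cnt_line_ge2 hS dl PS Pl) andbT.
have := cnt_star_ge1 hS PS Pl lT dl dT; rewrite cT theta2 -/(cnt S l); lia.
Qed.
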